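(* Assume $\mathbb{E}\|X_1\|^2<\infty$. Let $K_1:=2\,\mathbb{E}\|X_1\|$, let $C_1>0$, let $\tau=\frac{1}{n\sqrt d}$ with $C_1>2d\tau$, let $\theta_0\in\mathbb{R}^d$ be the true parameter with $\|\theta_0\|_1\le C_1-2d\tau$ and $s^*:=\|\theta_0\|_0$, $1\le s^*<n$, and put $$\varepsilon_n=\frac{K_1\vee 4s^*\log\left(\frac{C_1 n\sqrt d}{s^*}\right)}{n}.$$ Then for every $\alpha\in(0,1)$, $$\mathbb{E}\left[\int D_\alpha(P_\theta,P_{\theta_0})\,\pi_{n,\alpha}(\mathrm{d}\theta)\right]\le \frac{1+\alpha}{1-\alpha}\,\varepsilon_n .$$
   Context: Model: $Z_i=(Y_i,X_i)\in\{-1,1\}\times\mathbb{R}^d$, $i=1,\dots,n$, are i.i.d. For $\theta\in\mathbb{R}^d$, $P_\theta$ is the joint law of $(Y,X)$ for which $X$ has a fixed marginal law not depending on $\theta$ and $p_\theta(y|x)=\mathbb{P}(Y=y\mid X=x,\theta)=\frac{e^{yx^\top\theta}}{1+e^{yx^\top\theta}}$. The data are drawn from $\mathbb{P}=P_{\theta_0}^{\otimes n}$ (well-specified case) and $\mathbb{E}$ is expectation under $\mathbb{P}$. $\|\cdot\|=\|\cdot\|_2$ is the Euclidean norm, $\|\cdot\|_1$ the $\ell_1$ norm, $\|\theta\|_0$ the number of nonzero entries of $\theta$, and $a\vee b=\max(a,b)$. Prior: for $C_1>0$, $\tau>0$, $\pi$ is the probability distribution supported on $B_1(C_1)=\{\theta\in\mathbb{R}^d:\|\theta\|_1\le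 C_1\}$ with density $\pi(\theta)\propto\prod_{i=1}^d(\tau^2+\theta_i^2)^{-2}$ on $B_1(C_1)$. Fractional posterior: $\pi_{n,\alpha}(\mathrm{d}\theta)\propto L_n(\theta)^\alpha\,\pi(\mathrm{d}\theta)$, where $L_n(\theta)=\prod_{i=1}^n p_\theta(Y_i|X_i)$; it depends on the data $Z_1,\dots,Z_n$. Rényi divergence: for $\alpha\in(0,1)$ and probability measures $P,R$ dominated by $\mu$, $D_\alpha(P,R)=\frac{1}{\alpha-1}\log\int\left(\frac{\mathrm{d}P}{\mathrm{d}\mu}\right)^\alpha\left(\frac{\mathrm{d}R}{\mathrm{d}\mu}\right)^{1-\alpha}\mathrm{d}\mu$. *)

(* Defs.v *)
From HB Require Import structures.
From mathcomp Require Import all_boot all_order all_algebra.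
From mathcomp Require Import all_classical all_reals all_analysis.
From mathcomp Require Import measurable_realfun.

Set Implicit Arguments.
Unset Strict Implicit.
Unset Printing Implicit Defensive.

Import Order.TTheory GRing.Theory Num.Theory.
Import numFieldNormedType.Exports.

Local Open Scope classical_set_scope.
Local Open Scope ring_scope.

(* The space R^d is [d.-tuple R] with the product of the Borel sigma-algebras,
   which is the measurable structure the library puts on tuples. *)
Section euclidean_space.
Context {R : realType} {d : nat}.
Implicit Types x t : d.-tuple R.

Definition dot x t : R := \sum_(i < d) tnth x i * tnth t i.

Definition norm0 t : nat := #|[pred i : 'I_d | tnth t i != 0]|.

Definition norm1 t : R := \sum_(i < d) `|tnth t i|.

Definition norm2 t : R := Num.sqrt (\sum_(i < d) tnth t i ^+ 2).

Lemma measurable_dot t : measurable_fun [set: d.-tuple R] (dot ^~ t).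
Proof.
apply: measurable_sum => i.
by apply: measurable_funM => //; exact: measurable_tnth.
Qed.

End euclidean_space.

(* The n-fold product measure m (x) ... (x) m on n-tuples, obtained by iterating
   the binary product along (t, s) |-> t :: s. *)
Fixpoint tuple_measure {dT} {T : measurableType dT} {R : realType}
    (m : set T -> \bar R) (n : nat) : set (n.-tuple T) -> \bar R :=
  match n with
  | 0 => \d_([tuple] : 0.-tuple T)
  | n'.+1 => pushforward (product_measure1 m (tuple_measure m (n := n')))
               (fun ts : T * n'.-tuple T => [tuple of ts.1 :: ts.2])
  end.
Arguments tuple_measure {dT T R} m n _.

Definition lebesgue_tuple (R : realType) (d : nat) : set (d.-tuple R) -> \bar R :=
  tuple_measure (@lebesgue_measure R) d.

(* Meaningful when the total mass of w is positive and finite, as is the case of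
   the prior and of the fractional posterior below. *)
Definition normalized_density {dT} {T : measurableType dT} {R : realType}
    (m : set T -> \bar R) (w : T -> R) : set T -> \bar R :=
  fun A => ((\int[m]_(t in A) (w t)%:E) / (\int[m]_t (w t)%:E))%E.

(* The logarithm is extended-real valued, so that the divergence of mutually
   singular measures is +oo. *)
Definition renyi {dT} {T : measurableType dT} {R : realType}
    (nu : {sigma_finite_measure set T -> \bar R}) (alpha : R)
    (P Q : probability T R) : \bar R :=
  let p := Radon_Nikodym (charge_of_finite_measure P) nu in
  let q := Radon_Nikodym (charge_of_finite_measure Q) nu in
  (((alpha - 1)^-1)%:E *
    lne (\int[nu]_z (poweR (p z) alpha * poweR (q z) (1 - alpha))))%E.

Section logistic_model.
Context {R : realType} {d : nat}.
Implicit Types (x t : d.-tuple R) (y : bool).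

(* The label set {-1, 1} is encoded by [bool]. *)
Definition label y : R := if y then 1 else -1.

Definition logit_pmf t y x : R :=
  expR (label y * dot x t) / (1 + expR (label y * dot x t)).

Lemma logit_pmf_ge0 t y x : 0 <= logit_pmf t y x.
Proof. by rewrite divr_ge0 ?addr_ge0 ?expR_ge0. Qed.

Lemma logit_pmf_sum t x : \sum_(y : bool) logit_pmf t y x = 1.
Proof.
rewrite big_bool /logit_pmf /= !mul1r mulN1r expRN.
set e := expR _.
have e0 : 0 < e by exact: expR_gt0.
have -> : e^-1 / (1 + e^-1) = (1 + e)^-1.
  by rewrite -invfM mulrDr mulr1 divff ?gt_eqF// addrC.
by rewrite -[X in _ + X]mul1r -mulrDl addrC divff// gt_eqF// addr_gt0.
Qed.

Lemma measurable_logit_pmf t y :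
  measurable_fun [set: d.-tuple R] (logit_pmf t y).
Proof.
pose sigmoid (a : R) := expR a / (1 + expR a).
apply: (@measurableT_comp _ _ _ _ _ _ sigmoid _ (fun x => label y * dot x t)).
  apply: continuous_measurable_fun => a.
  apply: cvgM; first exact: continuous_expR.
  apply: cvgV; first by rewrite gt_eqF// addr_gt0 ?expR_gt0.
  by apply: cvgD; [exact: cvg_cst|exact: continuous_expR].
by apply: measurable_funM => //; exact: measurable_dot.
Qed.

End logistic_model.

(* The law of (Y, X) when X has law mu and Y given X = x has mass function
   [logit_pmf t ^~ x]. *)
Section logit_law.
Context {R : realType} {d : nat}.
Variables (mu : probability (d.-tuple R) R) (t : d.-tuple R).
Local Open Scope ereal_scope.

Definition logit_law : set (bool * d.-tuple R) -> \bar R :=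
  fun A => \sum_(y : bool) \int[mu]_(x in xsection A y) (logit_pmf t y x)%:E.

Let logit_law0 : logit_law set0 = 0.
Proof.
by rewrite /logit_law big1// => y _; rewrite xsection0 integral_set0.
Qed.

Let logit_law_ge0 A : 0 <= logit_law A.
Proof.
apply: sume_ge0 => y _; apply: integral_ge0 => x _.
by rewrite lee_fin logit_pmf_ge0.
Qed.

Let logit_law_sigma_additive : semi_sigma_additive logit_law.
Proof.
have add y : semi_sigma_additive
    (fun B => \int[mu]_(x in B) (logit_pmf t y x)%:E).
  apply: semi_sigma_additive_nng_induced => [|x].
    by apply/measurable_EFinP; exact: measurable_logit_pmf.
  by rewrite lee_fin logit_pmf_ge0.
move=> F mF tF mUF.
have cvgy y : \sum_(0 <= i < n) \int[mu]_(x in xsection (F i) y)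
      (logit_pmf t y x)%:E @[n --> \oo] -->
    \int[mu]_(x in xsection (\bigcup_n F n) y) (logit_pmf t y x)%:E.
  rewrite xsection_bigcup; apply: (add y (fun i => xsection (F i) y)).
  - by move=> i; exact: measurable_xsection.
  - exact: trivIset_xsection.
  - by apply: bigcup_measurable => i _; exact: measurable_xsection.
rewrite /logit_law big_bool; set u := (X in X @ _ --> _).
have -> : u = fun n =>
    \sum_(0 <= i < n)
      \int[mu]_(x in xsection (F i) true) (logit_pmf t true x)%:E +
    \sum_(0 <= i < n)
      \int[mu]_(x in xsection (F i) false) (logit_pmf t false x)%:E.
  apply/funext => n; rewrite /u -big_split; apply: eq_bigr => i _.
  by rewrite big_bool.
apply: cvgeD; [|exact: cvgy..].
apply: ge0_adde_def; rewrite inE; apply: integral_ge0 => x _;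
  by rewrite lee_fin logit_pmf_ge0.
Qed.

HB.instance Definition _ := isMeasure.Build _ _ _ logit_law
  logit_law0 logit_law_ge0 logit_law_sigma_additive.

Let logit_law_setT : logit_law setT = 1.
Proof.
rewrite /logit_law; under eq_bigr => y _.
  rewrite (_ : xsection setT y = setT); last first.
    by apply/seteqP; split => // x _; rewrite /xsection/= inE.
  over.
rewrite -ge0_integral_sum//=; last 2 first.
- by move=> y; apply/measurable_EFinP; exact: measurable_logit_pmf.
- by move=> y x _; rewrite lee_fin logit_pmf_ge0.
under eq_integral do rewrite sumEFin logit_pmf_sum.
by rewrite integral_cst// [X in _ * X]probability_setT mule1.
Qed.

HB.instance Definition _ :=
  Measure_isProbability.Build _ _ _ logit_law logit_law_setT.

End logit_law.

Section posterior.
Context {R : realType} {d : nat}.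
Implicit Types t : d.-tuple R.

Definition prior (tau C1 : R) : set (d.-tuple R) -> \bar R :=
  normalized_density (@lebesgue_tuple R d)
    (fun t => \1_[set t' | norm1 t' <= C1] t *
              \prod_(i < d) (tau ^+ 2 + tnth t i ^+ 2) ^- 2).

Definition likelihood (n : nat) (z : n.-tuple (bool * d.-tuple R)) t : R :=
  \prod_(i < n) logit_pmf t (tnth z i).1 (tnth z i).2.

Definition fractional_posterior (n : nat) (alpha : R)
    (pi : set (d.-tuple R) -> \bar R) (z : n.-tuple (bool * d.-tuple R)) :
    set (d.-tuple R) -> \bar R :=
  normalized_density pi (fun t => likelihood z t `^ alpha).

End posterior.

(* Main.v *)
(* Write H(t) for the Hellinger integral E_{theta0}[(p_t / p_theta0)^alpha], so
   that D_alpha(P_t, P_theta0) = - log H(t) / (1 - alpha), and Q(t, z) for the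
   likelihood ratio to the power alpha, whose expectation in z is H(t)^n.

   PAC-Bayes: if N(z) = int Q(t, z) pi(dt) >= exp (- U(z)), then the inequality
   a + 1 <= exp (a - u) + u at a = - n log H(t), integrated against the posterior
   Q(t, z) pi(dt) / N(z) and then over z, gives
   E[int - n log H(t) pi_{n,alpha}(dt)] <= E[U], because
   E[int H(t)^-n Q(t, z) pi(dt)] = 1.

   Prior mass: with s = |theta0|_0 and x = C1 / (tau s), the prior mass of the
   Euclidean ball of radius 2 sqrt d tau = 2 / n around theta0 is at least
   x^(-4 s).  Indeed the prior density dominates a product density which is
   Student off the support of theta0 and uniform on an interval of radius
   3/2 tau around theta0_i on the support; Chebyshev's inequality bounds the
   mass that this product gives to the ball, the ball lies in the l1 ball
   {|t|_1 <= C1}, and the product of the normalizing constants is controlled by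
   the arithmetic-geometric mean inequality.  On the ball the log-likelihood
   ratio is at least - (2 / n) sum_i |X_i|, the logit loss being 1-Lipschitz.
   Hence U(z) = (2 alpha / n) sum_i |X_i| + 4 s log x is admissible, and
   E[U] <= (1 + alpha) n eps_n. *)

From HB Require Import structures.
Require Import Defs.
From mathcomp Require Import all_boot all_order all_algebra.
From mathcomp Require Import all_classical all_reals all_analysis.
From mathcomp Require Import measurable_realfun ring lra.

Set Implicit Arguments.
Unset Strict Implicit.
Unset Printing Implicit Defensive.

Import Order.TTheory GRing.Theory Num.Theory.
Import numFieldNormedType.Exports.

Local Open Scope classical_set_scope.
Local Open Scope ring_scope.

(** * Measures with a density and product measures *)

Section mixture.
Local Open Scope ereal_scope.
Context {dT} {T : measurableType dT} {dU} {U : measurableType dU} {R : realType}.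
Variables (m : {measure set T -> \bar R}) (I : finType).
Variables (M : {measure set U -> \bar R}) (phi : I -> U -> T) (w : I -> U -> R).
Hypotheses (mphi : forall i, measurable_fun setT (phi i))
  (mw : forall i, measurable_fun setT (w i)) (w0 : forall i u, (0 <= w i u)%R).
Hypothesis mE : forall A, measurable A ->
  m A = \sum_i \int[M]_(u in phi i @^-1` A) (w i u)%:E.

Import HBNNSimple.

(** The identity is [mE] for indicators, passes to simple functions by linearity, and to nonnegative
    measurable functions by monotone convergence along [nnsfun_approx]. With [I := unit] it
    integrates against a density, with [I := bool] against the law of a labelled pair. *)
Lemma ge0_integral_mixture (f : T -> \bar R) :
  measurable_fun setT f -> (forall t, 0 <= f t) ->
  \int[m]_t f t = \sum_i \int[M]_u (f (phi i u) * (w i u)%:E).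
Proof.
move=> mf f0.
have mwE i : measurable_fun setT (EFin \o w i) by exact/measurable_EFinP.
have indicE A : measurable A ->
    m A = \sum_i \int[M]_u ((\1_A (phi i u))%:E * (w i u)%:E).
  move=> mA; rewrite mE//; apply: eq_bigr => i _.
  rewrite integral_mkcond; apply: eq_integral => u _.
  rewrite patchE indicE; case: ifPn => [|] /=; rewrite ?inE ?notin_setE /= => uA.
    by rewrite mem_set// mul1e.
  by rewrite memNset// mul0e.
have sfunE (g : {nnsfun T >-> R}) :
    \int[m]_t (g t)%:E = \sum_i \int[M]_u ((g (phi i u))%:E * (w i u)%:E).
  rewrite integralT_nnsfun sintegralE.
  transitivity (\sum_(r \in range g) \sum_i \int[M]_u
      (r%:E * ((\1_(g @^-1` [set r]) (phi i u))%:E * (w i u)%:E))).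
    apply: eq_fsbigr => r; rewrite inE => -[t _ <-{r}].
    rewrite indicE; last exact: measurable_sfunP.
    rewrite ge0_sume_distrr; last first.
      by move=> i _; apply: integral_ge0 => u _; rewrite mule_ge0// lee_fin.
    apply: eq_bigr => i _; rewrite ge0_integralZl//.
    - apply: emeasurable_funM; last exact: mwE.
      by apply/measurable_EFinP; exact: measurableT_comp.
    - by move=> u _; rewrite mule_ge0// lee_fin.
    - by rewrite lee_fin.
  rewrite fsbig_finite//= exchange_big; apply: eq_bigr => i _.
  rewrite -fsbig_finite// -ge0_integral_fsum//; last 2 first.
  - move=> r; apply: measurable_funeM; apply: emeasurable_funM; last exact: mwE.
    by apply/measurable_EFinP; exact: measurableT_comp.
  - move=> r u _; rewrite muleA; apply: mule_ge0; last by rewrite lee_fin.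
    by rewrite -EFinM nnfun_muleindic_ge0.
  apply: eq_integral => u _; rewrite fimfunE -fsumEFin//.
  rewrite !fsbig_finite//= ge0_sume_distrl.
    by apply: eq_bigr => r _; rewrite muleA EFinM.
  by move=> r _; rewrite EFinM nnfun_muleindic_ge0.
pose g := nnsfun_approx measurableT mf.
have gf t : (g n t)%:E @[n --> \oo] --> f t by exact: cvg_nnsfun_approx.
have lim_m : \int[m]_t (g n t)%:E @[n --> \oo] --> \int[m]_t f t.
  rewrite (_ : \int[m]_t f t = \int[m]_t limn (fun n => (g n t)%:E)); last first.
    by apply: eq_integral => t _; apply/esym/cvg_lim => //; exact: gf.
  apply: cvg_monotone_convergence => //.
  - by move=> n; exact/measurable_EFinP.
  - by move=> n t _; rewrite lee_fin.
  - by move=> t _ a b ab; rewrite lee_fin; exact/lefP/nd_nnsfun_approx.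
have lim_M i : \int[M]_u ((g n (phi i u))%:E * (w i u)%:E) @[n --> \oo] -->
    \int[M]_u (f (phi i u) * (w i u)%:E).
  have -> : \int[M]_u (f (phi i u) * (w i u)%:E) =
      \int[M]_u limn (fun n => (g n (phi i u))%:E * (w i u)%:E).
    apply: eq_integral => u _; apply/esym/cvg_lim => //.
    by under eq_fun do rewrite muleC; rewrite muleC; apply: cvgeZl => //.
  apply: cvg_monotone_convergence => //.
  - move=> n; apply: emeasurable_funM; last exact: mwE.
    by apply/measurable_EFinP; exact: measurableT_comp.
  - by move=> n u _; rewrite mule_ge0// lee_fin.
  - move=> u _ a b ab; rewrite lee_pmul// ?lee_fin//.
    exact/lefP/nd_nnsfun_approx.
have := cvg_lim (@ereal_hausdorff R) lim_m => <-.
under eq_fun do rewrite sfunE.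
apply/cvg_lim => //; apply: cvg_nnesum => // i _.
by apply: nearW => n; apply: integral_ge0 => u _; rewrite mule_ge0// lee_fin.
Qed.

End mixture.

(** * Normalized densities as probability measures *)

Section normalized_density.
Local Open Scope ereal_scope.
Context {dT} {T : measurableType dT} {R : realType}.
Variables (m : {measure set T -> \bar R}) (w : T -> R).
Hypotheses (mw : measurable_fun setT w) (w0 : forall t, (0 <= w t)%R).
Hypotheses (Z_gt0 : 0 < \int[m]_t (w t)%:E) (Z_lty : \int[m]_t (w t)%:E < +oo).

Let Z : R := fine (\int[m]_t (w t)%:E).
Let ZE : \int[m]_t (w t)%:E = Z%:E.
Proof. by rewrite /Z fineK// ge0_fin_numE// ltW. Qed.
Let Z0 : (0 < Z)%R. Proof. by rewrite -lte_fin -ZE. Qed.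

Let nd0 : normalized_density m w set0 = 0.
Proof. by rewrite /normalized_density integral_set0 mul0e. Qed.

Let nd_ge0 A : 0 <= normalized_density m w A.
Proof.
rewrite /normalized_density ZE inver gt_eqF//; apply: mule_ge0.
  by apply: integral_ge0 => t _; rewrite lee_fin.
by rewrite lee_fin invr_ge0 ltW.
Qed.

Let normalized_densityE A : measurable A ->
  normalized_density m w A = \int[m]_(t in A) (w t / Z)%:E.
Proof.
move=> mA; rewrite /normalized_density ZE inver gt_eqF//.
under [RHS]eq_integral do rewrite EFinM.
rewrite ge0_integralZr//.
- exact/measurable_EFinP/measurable_funTS.
- by move=> t _; rewrite lee_fin.
- by rewrite lee_fin invr_ge0 ltW.
Qed.

Let nd_sigma_additive : semi_sigma_additive (normalized_density m w).
Proof.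
move=> F mF tF mUF; rewrite normalized_densityE//.
under eq_fun do under eq_bigr do rewrite normalized_densityE//.
apply: (semi_sigma_additive_nng_induced (f := fun t => (w t / Z)%:E)) => //.
  by apply/measurable_EFinP; exact: measurable_funM.
by move=> t; rewrite lee_fin divr_ge0// ltW.
Qed.

Let nd_setT : normalized_density m w setT = 1.
Proof.
by rewrite /normalized_density ZE inver gt_eqF// -EFinM divff// gt_eqF.
Qed.

(** [normalized_density] is a bare set function. The existential form lets a rewrite replace it by a
    genuine probability, to which the integration theory applies; positivity and finiteness of the
    total mass make the division harmless. *)
Lemma normalized_density_probability :
  exists p : probability T R, normalized_density m w = p :> (set T -> \bar R).
Proof.
pose H0 := isMeasure.Build _ _ _ (normalized_density m w)
  nd0 nd_ge0 nd_sigma_additive.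
pose m' : {measure set T -> \bar R} := HB.pack (normalized_density m w) H0.
pose H1 := Measure_isProbability.Build _ _ _ m' nd_setT.
pose p : probability T R := HB.pack (normalized_density m w) m' H1.
by exists p.
Qed.

(** A mixture with a single component, of density [w / Z]. *)
Lemma integral_normalized_density (f : T -> \bar R) :
  measurable_fun setT f -> (forall t, 0 <= f t) ->
  \int[normalized_density m w]_t f t =
  (\int[m]_t (f t * (w t)%:E)) / (\int[m]_t (w t)%:E).
Proof.
move=> mf f0; have [p pE] := normalized_density_probability.
rewrite pE [LHS](ge0_integral_mixture (I := unit) (M := m) (phi := fun=> id)
  (w := fun _ t => (w t / Z)%R))//.
- rewrite big_const card_unit/= addr0 ZE inver gt_eqF//.
  under eq_integral do rewrite EFinM muleA.
  rewrite ge0_integralZr//.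
  + by apply: emeasurable_funM => //; exact/measurable_EFinP.
  + by move=> t _; rewrite mule_ge0// lee_fin.
  + by rewrite lee_fin invr_ge0 ltW.
- by move=> _; exact: measurable_funM.
- by move=> _ t; rewrite divr_ge0// ltW.
- by move=> A mA; rewrite big_const card_unit/= addr0 -pE normalized_densityE.
Qed.

End normalized_density.

Section logit_integral.
Local Open Scope ereal_scope.
Context {R : realType} {d : nat}.
Variables (mu : probability (d.-tuple R) R) (t : d.-tuple R).

(** A mixture with one component per label [y]: the image of [mu] under [x |-> (y, x)], weighted by
    the conditional mass function. *)
Lemma integral_logit_law (f : bool * d.-tuple R -> \bar R) :
  measurable_fun setT f -> (forall z, 0 <= f z) ->
  \int[logit_law mu t]_z f z =
  \sum_(y : bool) \int[mu]_x (f (y, x) * (logit_pmf t y x)%:E).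
Proof.
move=> mf f0.
apply: (@ge0_integral_mixture _ _ _ _ _ (logit_law mu t) _ mu
  (fun (y : bool) x => (y, x)) (fun y => logit_pmf t y)) => //.
- by move=> y; exact: pair1_measurable.
- by move=> y; exact: measurable_logit_pmf.
- by move=> y x; exact: logit_pmf_ge0.
- move=> A mA; rewrite /logit_law/=; apply: eq_bigr => y _.
  congr (integral _ _ _); apply/seteqP; split => x;
    by rewrite /xsection/= inE.
Qed.

End logit_integral.

(** * Iterated product measures on tuples *)

Section tuple_measure.
Local Open Scope ereal_scope.
Context {dT} {T : measurableType dT} {R : realType}.

Let cons_pair n (ts : T * n.-tuple T) : n.+1.-tuple T := [tuple of ts.1 :: ts.2].

Let measurable_cons_pair n : measurable_fun setT (@cons_pair n).
Proof. exact: measurable_cons. Qed.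

(** Each step of the iteration needs a sigma-finite measure on the shorter tuples, both for the
    product and for Tonelli's theorem. The cover consists of the rectangles [F i x G j] built from
    covers of the two factors. *)
Lemma tuple_measure_sigma_finite (m : {sigma_finite_measure set T -> \bar R}) n :
  exists M : {sigma_finite_measure set (n.-tuple T) -> \bar R},
    tuple_measure m n = M :> (set _ -> \bar R).
Proof.
elim: n => [|n [M IH]] /=; first by exists (\d_([tuple] : 0.-tuple T)).
rewrite IH.
have [F FT mF] := sigma_finiteT m; have [G GT mG] := sigma_finiteT M.
have sf : sigma_finite setT (pushforward (m \x M) (@cons_pair n)).
  pose uncons (u : n.+1.-tuple T) := (thead u, [tuple of behead u]).
  have munc : measurable_fun setT uncons.
    apply/measurable_fun_pairP; split; first exact: measurable_tnth.
    exact: measurable_behead.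
  (* The rectangles are enumerated by the codes of pairs of naturals; a number coding no pair gets
     the empty set. *)
  pose K (k : nat) : set (n.+1.-tuple T) :=
    if unpickle k is Some (i, j) then uncons @^-1` (F i `*` G j) else set0.
  exists K.
    apply/seteqP; split => // u _.
    have [i _ Fi] : (\bigcup_i F i) (thead u) by rewrite -FT.
    have [j _ Gj] : (\bigcup_j G j) [tuple of behead u] by rewrite -GT.
    by exists (pickle (i, j)) => //; rewrite /K pickleK.
  move=> k; rewrite /K; case: (unpickle k) => [[i j]|]; last first.
    by split => //; rewrite /pushforward preimage_set0 measure0.
  have [mFi Fi] := mF i; have [mGj Gj] := mG j.
  split.
    rewrite -[X in measurable X]setTI; apply: munc => //.
    exact: measurableX.
  rewrite /pushforward -comp_preimage.
  rewrite (_ : uncons \o @cons_pair n = id); last first.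
    apply/funext => -[x y]; rewrite /uncons /cons_pair/= theadE; congr pair.
    exact/val_inj.
  by rewrite preimage_id product_measure1E// lte_mul_pinfty// ge0_fin_numE.
pose nu : {measure set (n.+1.-tuple T) -> \bar R} :=
  measure_function_pushforward__canonical__measure_function_Measure
    (m \x M) (@measurable_cons_pair n).
pose H1 := Measure_isSigmaFinite.Build _ _ _ nu sf.
pose p : {sigma_finite_measure set (n.+1.-tuple T) -> \bar R} :=
  HB.pack (nu : set _ -> _) nu H1.
by exists p.
Qed.

(** Change of variables along the pushforward, then Tonelli's theorem. *)
Lemma integral_tuple_measureS (m : {sigma_finite_measure set T -> \bar R}) n
    (f : n.+1.-tuple T -> \bar R) :
  measurable_fun setT f -> (forall u, 0 <= f u) ->
  \int[tuple_measure m n.+1]_u f u =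
  \int[m]_x \int[tuple_measure m n]_t f [tuple of x :: t].
Proof.
move=> mf f0 /=; have [M ->] := tuple_measure_sigma_finite m n.
rewrite (ge0_integral_pushforward (@measurable_cons_pair n))//.
rewrite preimage_setT (fubini_tonelli1 (f \o @cons_pair n))//.
- by apply: (measurableT_comp mf); exact: measurable_cons_pair.
- by move=> x; exact: f0.
Qed.

(** Independence of the coordinates, by induction on [n]: the first factor leaves the inner
    integral. The factors may differ, so that a single coordinate can be singled out by taking the
    others equal to 1. *)
Lemma integral_tuple_measure_prod (m : {sigma_finite_measure set T -> \bar R}) n
    (g : 'I_n -> T -> R) :
  (forall i, measurable_fun setT (g i)) -> (forall i x, (0 <= g i x)%R) ->
  \int[tuple_measure m n]_u (\prod_(i < n) g i (tnth u i))%:E =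
  \prod_(i < n) \int[m]_x (g i x)%:E.
Proof.
elim: n g => [|n IH] g mg g0.
  rewrite /= big_ord0; under eq_integral do rewrite big_ord0.
  rewrite (integral_cst (\d_[tuple] : {measure set (0.-tuple T) -> \bar R}))//.
  by rewrite mul1e; exact: diracT.
have mp (k : nat) (h : 'I_k -> T -> R) : (forall i, measurable_fun setT (h i)) ->
    measurable_fun setT (fun u : k.-tuple T => \prod_(i < k) h i (tnth u i))%R.
  move=> mh; apply: measurable_prod => i _.
  by apply: (measurableT_comp (mh i)); exact: measurable_tnth.
rewrite integral_tuple_measureS; last 2 first.
- by apply/measurable_EFinP; exact: mp.
- by move=> u; rewrite lee_fin prodr_ge0.
have [M ME] := tuple_measure_sigma_finite m n.
transitivity (\int[m]_x ((g ord0 x)%:E *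
    \prod_(i < n) \int[m]_x (g (lift ord0 i) x)%:E)).
  apply: eq_integral => x _; rewrite -IH//.
  rewrite ME -ge0_integralZl//.
  - by apply: eq_integral => u _; rewrite big_ord_recl EFinM tnth0;
      under eq_bigr do rewrite tnthS.
  - by apply/measurable_EFinP; apply: (mp n (fun i => g (lift ord0 i))).
  - by move=> u _; rewrite lee_fin prodr_ge0.
  - by rewrite lee_fin.
rewrite ge0_integralZr//.
- by rewrite big_ord_recl.
- exact/measurable_EFinP.
- by move=> x _; rewrite lee_fin.
- by apply: prode_ge0 => i _; apply: integral_ge0 => x _; rewrite lee_fin.
Qed.

Lemma tuple_measure_setT (p : probability T R) n : tuple_measure p n setT = 1.
Proof.
have := @integral_tuple_measure_prod p n (fun _ _ => 1%R).
have [M ->] := tuple_measure_sigma_finite p n.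
under eq_integral do rewrite big1//.
rewrite integral_cst// mul1e => -> //.
apply: big1 => i _; rewrite integral_cst// mul1e; exact: probability_setT.
Qed.

End tuple_measure.

(** * The prior mass of a ball around the true parameter *)

Section student_integrals.
Context {R : realType}.
Variable tau : R.
Hypothesis tau_gt0 : 0 < tau.
Local Notation leb := (@lebesgue_measure R).

Let D (t : R) : R := tau ^+ 2 + t ^+ 2.

Let D_gt0 t : 0 < D t.
Proof. by rewrite /D ltr_wpDr ?sqr_ge0 ?exprn_gt0. Qed.

Let cD : continuous D.
Proof.
by move=> t; apply: cvgD; [exact: cvg_cst|exact: exprn_continuous].
Qed.

(* For s = 1, -1 these are 2 tau^3 / D^2 and 2 tau t^2 / D^2, with
   antiderivative atan (t / tau) + s tau t / D. *)
Let f (s t : R) : R := tau * (D t + s * (tau ^+ 2 - t ^+ 2)) / D t ^+ 2.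

Let cf s : continuous (f s).
Proof.
move=> t; apply: cvgM.
  apply: cvgM; first exact: cvg_cst.
  apply: cvgD; first exact: cD.
  apply: cvgM; first exact: cvg_cst.
  by apply: cvgB; [exact: cvg_cst|exact: exprn_continuous].
apply: cvgV; first by rewrite gt_eqF// exprn_gt0.
by apply: (@continuous_comp _ _ _ D (fun u : R => u ^+ 2));
  [exact: cD|exact: exprn_continuous].
Qed.

Let is_derive_F (s t : R) :
  is_derive t (1 : R) (fun u : R => atan (tau^-1 * u) + s * tau * u * (D u)^-1) (f s t).
Proof.
have dD : is_derive t (1 : R) D (2 * t).
  rewrite /D; apply: is_derive_eq.
  by rewrite add0r /GRing.scale/= mulr1; ring.
have D0 : D t != 0 by rewrite gt_eqF.
have dV := is_deriveV D0 dD.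
have d1 : is_derive t (1 : R) (fun u : R => atan (tau^-1 * u))
    ((1 + (tau^-1 * t) ^+ 2)^-1 * tau^-1).
  apply: is_derive1_comp.
  by apply: is_derive_eq; rewrite /GRing.scale/= mulr1.
have d2 : is_derive t (1 : R) (fun u : R => s * tau * u) (s * tau).
  by apply: is_derive_eq; rewrite /GRing.scale/= mulr1.
apply: (is_derive_eq (is_deriveD d1 (is_deriveM d2 dV))).
have t0 : tau != 0 by rewrite gt_eqF.
rewrite /GRing.scale/= /f.
rewrite (_ : 1 + (tau^-1 * t) ^+ 2 = D t / tau ^+ 2); last by rewrite /D; field.
move: D0; rewrite /D => D0; field.
by rewrite t0 D0.
Qed.

(** [f s] is even, and on the half-line its antiderivative increases from 0 to [pi / 2]. The
    condition on [s] ensures [f s >= 0]. *)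
Let integral_f s : (s == 1) || (s == -1) ->
  (\int[leb]_t (f s t)%:E)%E = pi%:E.
Proof.
move=> s1.
have f0 t : 0 <= f s t.
  rewrite /f divr_ge0 ?sqr_ge0//; apply: mulr_ge0; first exact: ltW.
  have := sqr_ge0 tau; have := sqr_ge0 t.
  by rewrite /D; case/orP : s1 => /eqP -> /=; rewrite ?mulN1r ?mul1r => *; lra.
rewrite ge0_symfun_integralT//; last 1 first.
  by move=> t; rewrite /f /D/= sqrrN.
have -> : [set x : R | 0 <= x] = `[0, +oo[%classic by rewrite -set_itvcy.
rewrite (@ge0_continuous_FTC2y _ (f s)
  (fun u => atan (tau^-1 * u) + s * tau * u * (D u)^-1) 0 (pi / 2)).
- by rewrite !mulr0 mul0r atan0 addr0 sube0 -EFinM mulrC divfK.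
- by move=> x _; exact: f0.
- exact: continuous_subspaceT.
- rewrite -[pi / 2]addr0; apply: cvgD.
    apply: (@cvg_comp _ _ _ (fun u => tau^-1 * u) atan); last exact: cvgy_atan.
    by apply: gt0_cvgMry; [rewrite invr_gt0|exact: cvg_id].
  (* The rational part of the antiderivative is at most [tau / t] in absolute value, hence at most
     [e] once [t >= tau / e]. *)
  apply/cvgr0Pnorm_le => /= e e0.
  near=> t.
  have t0 : 0 < t by near: t; exact: nbhs_pinfty_gt.
  rewrite normrM normfV (gtr0_norm (D_gt0 t)) ler_pdivrMr// !normrM.
  have -> : `|s| = 1 by case/orP : s1 => /eqP ->; rewrite ?normrN normr1.
  rewrite mul1r (gtr0_norm tau_gt0) (gtr0_norm t0).
  have : tau / e <= t by near: t; apply: nbhs_pinfty_ge; exact: num_real.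
  rewrite ler_pdivrMr// => te; rewrite /D.
  have h1 : tau * t <= t * e * t by rewrite ler_pM2r.
  have h2 : 0 <= e * tau ^+ 2 by rewrite mulr_ge0 ?sqr_ge0// ltW.
  by rewrite mulrDr; move: h1 h2; rewrite expr2; lra.
- by move=> x _; have := is_derive_F s x => /@ex_derive.
- apply: cvg_at_right_filter.
  have /@ex_derive/derivable1_diffP := is_derive_F s 0.
  by move=> /differentiable_continuous.
- by move=> x _; rewrite derive1E; have := is_derive_F s x => /@derive_val.
Unshelve. all: by end_near. Qed.

Lemma integral_student :
  (\int[leb]_t ((tau ^+ 2 + t ^+ 2) ^- 2)%:E)%E = (pi / (2 * tau ^+ 3))%:E.
Proof.
have t0 : tau != 0 by rewrite gt_eqF.
transitivity (\int[leb]_t ((2 * tau ^+ 3)^-1%:E * (f 1 t)%:E))%E.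
  apply: eq_integral => t _; rewrite -EFinM; congr EFin.
  by rewrite /f; have := D_gt0 t; rewrite /D => /gt_eqF/negbT D0; field; rewrite t0 D0.
rewrite ge0_integralZl//.
- by rewrite integral_f ?eqxx// -EFinM mulrC.
- by apply/measurable_EFinP; apply: continuous_measurable_fun; exact: cf.
- move=> t _; rewrite lee_fin /f divr_ge0 ?sqr_ge0//; apply: mulr_ge0; first exact: ltW.
  by rewrite /D; have := sqr_ge0 tau; have := sqr_ge0 t; lra.
- by rewrite lee_fin invr_ge0 mulr_ge0// exprn_ge0// ltW.
Qed.

(** Compared with [integral_student], this says that the normalized density has second moment
    [tau ^+ 2]. *)
Lemma integral_sqr_student :
  (\int[leb]_t (t ^+ 2 * (tau ^+ 2 + t ^+ 2) ^- 2)%:E)%E =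
  (pi / (2 * tau))%:E.
Proof.
have t0 : tau != 0 by rewrite gt_eqF.
transitivity (\int[leb]_t ((2 * tau)^-1%:E * (f (-1) t)%:E))%E.
  apply: eq_integral => t _; rewrite -EFinM; congr EFin.
  by rewrite /f; have := D_gt0 t; rewrite /D => /gt_eqF/negbT D0; field; rewrite t0 D0.
rewrite ge0_integralZl//.
- by rewrite integral_f ?eqxx ?orbT// -EFinM mulrC.
- by apply/measurable_EFinP; apply: continuous_measurable_fun; exact: cf.
- move=> t _; rewrite lee_fin /f divr_ge0 ?sqr_ge0//; apply: mulr_ge0; first exact: ltW.
  by rewrite /D; have := sqr_ge0 tau; have := sqr_ge0 t; lra.
- by rewrite lee_fin invr_ge0 mulr_ge0// ltW.
Qed.

End student_integrals.

(** * Chebyshev's inequality for an unnormalized product density *)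

Section product_chebyshev.
Local Open Scope ereal_scope.
Context {dT} {T : measurableType dT} {R : realType}.
Variables (m : {sigma_finite_measure set T -> \bar R}) (n : nat).
Variables (g h : 'I_n -> T -> R) (J e : 'I_n -> R).
Hypotheses (mg : forall i, measurable_fun setT (g i))
  (mh : forall i, measurable_fun setT (h i)).
Hypotheses (g0 : forall i x, (0 <= g i x)%R) (h0 : forall i x, (0 <= h i x)%R).
Hypothesis gJ : forall i, \int[m]_x (g i x)%:E = (J i)%:E.
Hypothesis hJ : forall i, \int[m]_x (h i x * g i x)%:E <= (e i * J i)%:E.
Local Notation prodg u := (\prod_(i < n) g i (tnth u i))%R.

Let measurable_prodg (f : 'I_n -> T -> R) :
  (forall i, measurable_fun setT (f i)) ->
  measurable_fun setT (fun u : n.-tuple T => \prod_(i < n) f i (tnth u i))%R.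
Proof.
move=> mf; apply: measurable_prod => i _.
by apply: (measurableT_comp (mf i)); exact: measurable_tnth.
Qed.

Let J0 i : (0 <= J i)%R.
Proof. by rewrite -lee_fin -gJ integral_ge0// => x _; rewrite lee_fin. Qed.

Let prodg0 (u : n.-tuple T) : (0 <= prodg u)%R.
Proof. exact: prodr_ge0. Qed.

Lemma integral_tuple_prodg :
  \int[tuple_measure m n]_u (prodg u)%:E = (\prod_(i < n) J i)%:E.
Proof.
rewrite integral_tuple_measure_prod// -prodEFin.
by apply: eq_bigr => i _; exact: gJ.
Qed.

(** Where the product density does not vanish, [B <= B * \1_K + \sum_i h i]. Integrating this
    against the density gives the bound, stated without dividing by [B] or by the total mass. *)
Lemma product_chebyshev (K : set (n.-tuple T)) (B : R) : measurable K ->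
  (0 <= B)%R ->
  (forall u, prodg u != 0%R -> ~ K u -> (B <= \sum_(i < n) h i (tnth u i))%R) ->
  ((B - \sum_(i < n) e i) * \prod_(i < n) J i)%:E <=
  B%:E * \int[tuple_measure m n]_u (\1_K u * prodg u)%:E.
Proof.
move=> mK B0 KB.
(* Absorbing [h j] into the factor of index [j] keeps the integrand a product, so its integral
   factorizes. *)
have int1 j : \int[tuple_measure m n]_u (h j (tnth u j) * prodg u)%:E <=
    (e j * \prod_(i < n) J i)%:E.
  pose k i x := (if i == j then h i x * g i x else g i x)%R.
  have -> : \int[tuple_measure m n]_u (h j (tnth u j) * prodg u)%:E =
      \int[tuple_measure m n]_u (\prod_(i < n) k i (tnth u i))%:E.
    have [M ->] := tuple_measure_sigma_finite m n.
    apply: eq_integral => u _; congr EFin.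
    rewrite (bigD1 j)//= [RHS](bigD1 j)//= mulrA /k eqxx; congr (_ * _)%R.
    by apply: eq_bigr => i /negbTE ->.
  rewrite integral_tuple_measure_prod.
  - rewrite (bigD1 j)//= [in leRHS](bigD1 j)//= mulrA [in leRHS]EFinM.
    rewrite -prodEFin /k eqxx.
    under eq_bigr => i /negbTE ij.
      under eq_integral do rewrite ij.
      rewrite gJ; over.
    apply: lee_wpmul2r; last exact: hJ.
    by rewrite prodEFin lee_fin prodr_ge0.
  - move=> i; rewrite /k; case: eqP => // _.
    exact: measurable_funM.
  - by move=> i x; rewrite /k; case: eqP => // _; rewrite mulr_ge0.
have [M ME] := tuple_measure_sigma_finite m n.
have mKg : measurable_fun setT (fun u : n.-tuple T => (\1_K u * prodg u)%:E).
  apply/measurable_EFinP; apply: measurable_funM => //.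
  exact: measurable_prodg.
have mhg j : measurable_fun setT
    (fun u : n.-tuple T => (h j (tnth u j) * prodg u)%:E).
  apply/measurable_EFinP; apply: measurable_funM; last exact: measurable_prodg.
  by apply: (measurableT_comp (mh j)); exact: measurable_tnth.
have Kg0 (u : n.-tuple T) : 0 <= (\1_K u * prodg u)%:E.
  by rewrite lee_fin mulr_ge0.
have hg0 j (u : n.-tuple T) : 0 <= (h j (tnth u j) * prodg u)%:E.
  by rewrite lee_fin mulr_ge0.
have : B%:E * \int[tuple_measure m n]_u (prodg u)%:E <=
    B%:E * \int[tuple_measure m n]_u (\1_K u * prodg u)%:E +
    \sum_(j < n) \int[tuple_measure m n]_u (h j (tnth u j) * prodg u)%:E.
  rewrite ME -!ge0_integralZl//; last 2 first.
  - by apply/measurable_EFinP; exact: measurable_prodg.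
  - by move=> u _; rewrite lee_fin.
  rewrite -ge0_integral_sum// -ge0_integralD//; last 4 first.
  - by move=> u _; rewrite mule_ge0.
  - exact: measurable_funeM.
  - by move=> u _; apply: sume_ge0.
  - by apply: emeasurable_sum.
  apply: ge0_le_integral => //.
  - by move=> u _; rewrite mule_ge0// lee_fin.
  - by apply: measurable_funeM; apply/measurable_EFinP; exact: measurable_prodg.
  - by apply: emeasurable_funD; [exact: measurable_funeM|exact: emeasurable_sum].
  move=> u _; rewrite sumEFin -!EFinM -EFinD lee_fin -mulr_suml.
  have hs : (0 <= \sum_(i < n) h i (tnth u i))%R by apply: sumr_ge0.
  (* Three cases: the density vanishes, [u] lies in [K], or the sum of the [h i] is at least [B]. *)
  have [g_eq0|g_neq0] := eqVneq (prodg u) 0%R; first by rewrite g_eq0 !mulr0 addr0.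
  rewrite indicE; have [uK|uK] := boolP (u \in K).
    by rewrite mul1r lerDl mulr_ge0.
  rewrite mul0r mulr0 add0r ler_wpM2r//; apply: KB => //.
  by move/negP : uK; rewrite inE.
rewrite integral_tuple_prodg => le1.
rewrite mulrBl EFinB leeBlDr//; apply: (le_trans le1).
rewrite leeD2l// mulr_suml -sumEFin; apply: lee_sum => j _; exact: int1.
Qed.

End product_chebyshev.

(* The library's Borel structure on [R] and the structure [measurableTypeR R]
   carried by [lebesgue_measure] have the same measurable sets but different
   proof fields, so they are only propositionally equal. *)
Lemma measurable_class_transport (X : Type)
    (P : forall d, Measurable.axioms_ d X -> Prop)
    d1 d2 (c1 : Measurable.axioms_ d1 X) (c2 : Measurable.axioms_ d2 X) :
  Measurable.classical_sets_isPointed_mixin c1 =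
    Measurable.classical_sets_isPointed_mixin c2 ->
  Measurable.choice_hasChoice_mixin c1 = Measurable.choice_hasChoice_mixin c2 ->
  Measurable.eqtype_hasDecEq_mixin c1 = Measurable.eqtype_hasDecEq_mixin c2 ->
  @measurable d1 (Measurable.Pack c1) = @measurable d2 (Measurable.Pack c2)
    :> set (set X) ->
  P d1 c1 -> P d2 c2.
Proof.
case: d1 c1; case: d2 c2.
case=> [a1 a2 a3 [m0 p0 pI pD] [pU] [pC] [pT]].
case=> [b1 b2 b3 [n0 q0 qI qD] [qU] [qC] [qT]] /=.
rewrite /measurable/=.
move=> e1 e2 e3 e4; subst.
by rewrite (Prop_irrelevance p0 q0) (Prop_irrelevance pI qI)
  (Prop_irrelevance pD qD) (Prop_irrelevance pU qU) (Prop_irrelevance pC qC)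
  (Prop_irrelevance pT qT).
Qed.

Section lebesgue_canonical.
Context {R : realType}.

(** Provides a copy of Lebesgue measure on the canonical Borel structure of [R], to which the
    results on tuple measures apply. *)
Lemma lebesgue_canonical :
  exists leb : {sigma_finite_measure set R -> \bar R},
    (forall d, @lebesgue_tuple R d = tuple_measure leb d) /\
    (forall f : R -> \bar R,
      (\int[leb]_x f x = \int[@lebesgue_measure R]_x f x)%E).
Proof.
(* The claim is phrased as a predicate of the measurable structure: it is trivial for the structure
   carried by [lebesgue_measure], and is then transported. *)
pose P d (c : Measurable.axioms_ d R) :=
  exists leb : @SigmaFiniteMeasure.type d (Measurable.Pack c) R,
    (forall n, @lebesgue_tuple R n =
      @tuple_measure d (Measurable.Pack c) R leb n :> (set (n.-tuple R) -> \bar R)) /\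
    (forall f : R -> \bar R, @integral d (Measurable.Pack c) R leb setT f =
      (\int[@lebesgue_measure R]_x f x)%E).
apply: (@measurable_class_transport R P _ _
  (Measurable.class (measurableTypeR R)) (Measurable.class (R : measurableType _))) => //.
by exists (@lebesgue_measure R).
Qed.

End lebesgue_canonical.

(** * Lower bound on the prior mass of the ball *)

Section prior_mass.
Context {R : realType} {d : nat}.
Variables (theta0 : d.-tuple R) (tau C1 : R).
Hypothesis tau_gt0 : 0 < tau.
Hypothesis s_gt0 : (0 < norm0 theta0)%N.
Hypothesis theta0_le : norm1 theta0 <= C1 - 2 * d%:R * tau.
Let leb : {sigma_finite_measure set R -> \bar R} :=
  sval (cid (@lebesgue_canonical R)).
Let lebE : @lebesgue_tuple R d = tuple_measure leb d.
Proof. by rewrite /leb; case: cid => leb' [/= + _]; exact. Qed.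
Let lebI (f : R -> \bar R) :
  (\int[leb]_x f x = \int[@lebesgue_measure R]_x f x)%E.
Proof. by rewrite /leb; case: cid => leb' [/= _]; exact. Qed.
Local Notation s := (norm0 theta0).

Definition student_weight (t : d.-tuple R) : R :=
  \prod_(i < d) (tau ^+ 2 + tnth t i ^+ 2) ^- 2.

Definition prior_weight (t : d.-tuple R) : R :=
  \1_[set t' | norm1 t' <= C1] t * student_weight t.

(** The Euclidean ball of radius [2 * sqrt d * tau], written with squares. *)
Definition dist_ball : set (d.-tuple R) :=
  [set t | \sum_(i < d) (tnth t i - tnth theta0 i) ^+ 2 <=
           4 * d%:R * tau ^+ 2].

Let I0 : R := pi / (2 * tau ^+ 3).
(** Chosen so that [tau * b i = 2 * tau + |theta0_i|], whose square dominates [tau ^+ 2 + t ^+ 2] on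
    the interval used in [g]. *)
Let b i : R := 2 + `|tnth theta0 i| / tau.

Let tau0 : tau != 0. Proof. by rewrite gt_eqF. Qed.

Let D_gt0 (t : R) : 0 < tau ^+ 2 + t ^+ 2.
Proof. by rewrite ltr_wpDr ?sqr_ge0 ?exprn_gt0. Qed.

Let b_ge2 i : 2 <= b i.
Proof. by rewrite /b lerDl divr_ge0// ltW. Qed.

Let b_gt0 i : 0 < b i. Proof. exact: lt_le_trans (b_ge2 i). Qed.

(* On the support of theta0 the Student density is bounded below by a multiple
   of the indicator of an interval; elsewhere it is kept. *)
Let g (i : 'I_d) (t : R) : R :=
  if tnth theta0 i == 0 then (tau ^+ 2 + t ^+ 2) ^- 2
  else (tau ^+ 4 * b i ^+ 4)^-1 *
       \1_[set` `[tnth theta0 i - 3 / 2 * tau, tnth theta0 i + 3 / 2 * tau]] t.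

Let J (i : 'I_d) : R :=
  if tnth theta0 i == 0 then I0 else 3 / (tau ^+ 3 * b i ^+ 4).

(** Only the coordinates off the support go through Chebyshev's inequality: on the support, [g]
    already confines the deviation to [3 / 2 * tau]. *)
Let h (i : 'I_d) (t : R) : R := if tnth theta0 i == 0 then t ^+ 2 else 0.

Let e (i : 'I_d) : R := if tnth theta0 i == 0 then tau ^+ 2 else 0.

Let measurable_student : measurable_fun setT (fun t : R => (tau ^+ 2 + t ^+ 2) ^- 2).
Proof.
apply: continuous_measurable_fun => t; apply: cvgV.
  by rewrite gt_eqF// exprn_gt0.
apply: (@continuous_comp _ _ _ (fun t : R => tau ^+ 2 + t ^+ 2)
  (fun u : R => u ^+ 2)); last exact: exprn_continuous.
by apply: cvgD; [exact: cvg_cst|exact: exprn_continuous].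
Qed.

Let measurable_student_weight : measurable_fun setT student_weight.
Proof.
apply: measurable_prod => i _.
by apply: (measurableT_comp measurable_student); exact: measurable_tnth.
Qed.

Let student_weight_ge0 t : 0 <= student_weight t.
Proof. by apply: prodr_ge0 => i _; rewrite invr_ge0 sqr_ge0. Qed.

Lemma measurable_norm1 : measurable_fun setT (@norm1 R d).
Proof.
apply: measurable_sum => i.
by apply: measurableT_comp => //; exact: measurable_tnth.
Qed.

Lemma measurable_prior_weight : measurable_fun setT prior_weight.
Proof.
apply: measurable_funM => //; apply: measurable_indic.
rewrite -[X in measurable X]setTI.
have := measurable_norm1 measurableT (measurable_itv `]-oo, C1]).
by congr (measurable (_ `&` _)); apply/seteqP; split=> t /=; rewrite in_itv.
Qed.

Lemma prior_weight_ge0 t : 0 <= prior_weight t.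
Proof. by rewrite mulr_ge0. Qed.

Lemma measurable_dist_ball : measurable dist_ball.
Proof.
have mf : measurable_fun setT
    (fun t : d.-tuple R => \sum_(i < d) (tnth t i - tnth theta0 i) ^+ 2).
  apply: measurable_sum => i.
  apply: measurable_funX; apply: measurable_funB => //.
  exact: measurable_tnth.
have := mf measurableT _ (measurable_itv `]-oo, 4 * d%:R * tau ^+ 2]).
by rewrite setTI; congr measurable; apply/seteqP; split=> t /=; rewrite in_itv.
Qed.

Let mg i : measurable_fun setT (g i).
Proof.
by rewrite /g; case: eqP => // _; apply: measurable_funM.
Qed.

Let mh i : measurable_fun setT (h i).
Proof. by rewrite /h; case: eqP => // _; exact: exprn_measurable. Qed.

Let g0 i t : 0 <= g i t.
Proof.
rewrite /g; case: eqP => _; first by rewrite invr_ge0 sqr_ge0.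
by rewrite mulr_ge0// invr_ge0 mulr_ge0// exprn_ge0// ltW.
Qed.

Let h0 i t : 0 <= h i t.
Proof. by rewrite /h; case: eqP => _ //; exact: sqr_ge0. Qed.

Let gJ i : (\int[leb]_t (g i t)%:E = (J i)%:E)%E.
Proof.
rewrite lebI /g /J; case: eqP => _; first exact: integral_student.
under eq_integral do rewrite EFinM.
rewrite ge0_integralZl//; first last.
- by rewrite lee_fin invr_ge0 mulr_ge0// exprn_ge0// ltW.
- by apply/measurable_EFinP; exact: measurable_indic.
rewrite integral_indic// setIT [X in (_ * X)%E]lebesgue_measure_itv/= lte_fin.
rewrite ifT; last by have := tau_gt0; lra.
rewrite -EFinD -EFinM; congr EFin.
have bi0 : b i != 0 by rewrite gt_eqF.
by move: (b i) bi0 => B bi0; field; rewrite bi0 tau0.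
Qed.

Let hJ i : (\int[leb]_t (h i t * g i t)%:E <= (e i * J i)%:E)%E.
Proof.
rewrite lebI /h /g /e /J; case: eqP => _; last first.
  by under eq_integral do rewrite mul0r; rewrite integral0 mul0r.
rewrite (integral_sqr_student tau_gt0) lee_fin le_eqVlt; apply/orP; left.
by apply/eqP; rewrite /I0; field.
Qed.

(** With [a = theta0_i] and [|t| <= |a| + 3/2 tau], the sum [tau^2 + t^2] is at most
    [a^2 + 3 |a| tau + 13/4 tau^2], which is below [(|a| + 2 tau)^2]. *)
Let g_le i t : g i t <= (tau ^+ 2 + t ^+ 2) ^- 2.
Proof.
rewrite /g; case: eqP => // _; rewrite indicE.
case: (boolP (t \in _)) => [|_]; last by rewrite mulr0 invr_ge0 sqr_ge0.
rewrite inE/= in_itv/= => /andP[t1 t2]; rewrite mulr1.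
rewrite lef_pV2 ?posrE ?mulr_gt0 ?exprn_gt0//.
rewrite (_ : tau ^+ 4 * b i ^+ 4 = ((tau * b i) ^+ 2) ^+ 2); last by ring.
rewrite ler_pXn2r ?nnegrE ?sqr_ge0 ?ltW//.
set a := tnth theta0 i in t1 t2 *.
have -> : tau * b i = 2 * tau + `|a|.
  by rewrite /b -/a mulrDr mulrCA divff// mulr1 mulrC.
have ta : `|t| <= `|a| + 3 / 2 * tau.
  rewrite ler_norml; have := ler_norm a; have := ler_norm (- a); rewrite normrN.
  by move=> *; apply/andP; split; lra.
rewrite -[t ^+ 2]real_normK ?num_real//.
have := normr_ge0 t; have := normr_ge0 a; have := tau_gt0.
nra.
Qed.

Let prodg_le (t : d.-tuple R) :
  \prod_(i < d) g i (tnth t i) <= student_weight t.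
Proof. by apply: ler_prod => i _; rewrite g0 g_le. Qed.

(** The inequality [|y| <= y^2 / (4 tau) + tau], summed over the coordinates of [t - theta0], gives
    at most [d tau + d tau], exactly the slack left by [theta0_le]. *)
Let dist_ball_norm1 t : dist_ball t -> norm1 t <= C1.
Proof.
rewrite /dist_ball/= => tK.
suff : norm1 t <= norm1 theta0 + 2 * d%:R * tau by have := theta0_le; lra.
have amgm i : `|tnth t i| <= `|tnth theta0 i| +
    ((tnth t i - tnth theta0 i) ^+ 2 / (4 * tau) + tau).
  set x := tnth t i; set a := tnth theta0 i.
  have : `|x - a| <= (x - a) ^+ 2 / (4 * tau) + tau.
    rewrite -[(x - a) ^+ 2]real_normK ?num_real//; set y := `|x - a|.
    rewrite -subr_ge0.
    have -> : y ^+ 2 / (4 * tau) + tau - y = (y - 2 * tau) ^+ 2 / (4 * tau).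
      by field.
    by rewrite divr_ge0 ?sqr_ge0// mulr_ge0// ltW.
  have : `|x| <= `|a| + `|x - a|.
    by rewrite -{1}(subrK a x) addrC ler_normD.
  lra.
rewrite /norm1; apply: (le_trans (ler_sum _ (fun i _ => amgm i))).
rewrite !big_split/= lerD2l -mulr_suml sumr_const card_ord -mulr_natl.
have : (\sum_(i < d) (tnth t i - tnth theta0 i) ^+ 2) / (4 * tau) <= d%:R * tau.
  rewrite ler_pdivrMr ?mulr_gt0//; apply: (le_trans tK).
  by rewrite le_eqVlt; apply/orP; left; apply/eqP; ring.
lra.
Qed.

Let s_leq_d : (s <= d)%N.
Proof. by rewrite /norm0 -[X in (_ <= X)%N]card_ord; exact: max_card. Qed.

Let sum_supp : \sum_(i < d) (tnth theta0 i != 0)%:R = s%:R :> R.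
Proof.
rewrite -natr_sum /norm0 -sum1_card [in RHS]big_mkcond/=.
by congr (_%:R); apply: eq_bigr => i _; rewrite inE; case: eqP.
Qed.

Let sum_e : \sum_(i < d) e i = (d%:R - s%:R) * tau ^+ 2.
Proof.
transitivity (\sum_(i < d) (tau ^+ 2 - tau ^+ 2 * (tnth theta0 i != 0)%:R)).
  by apply: eq_bigr => i _; rewrite /e; case: eqP => _ /=; ring.
by rewrite sumrB sumr_const card_ord -mulr_sumr sum_supp -mulr_natl; ring.
Qed.

(** The squared radius minus the largest contribution of the [s] support coordinates, [9/4 tau^2]
    each: outside the ball, the other coordinates must account for at least [B]. *)
Let B : R := (4 * d%:R - 9 / 4 * s%:R) * tau ^+ 2.

Let s_le_d : s%:R <= d%:R :> R. Proof. by rewrite ler_nat. Qed.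

Let s_ge1 : 1 <= s%:R :> R. Proof. by rewrite ler1n. Qed.

Let B_gt0 : 0 < B.
Proof.
by rewrite /B mulr_gt0// ?exprn_gt0//; have := s_le_d; have := s_ge1; lra.
Qed.

Let notin_dist_ball u : \prod_(i < d) g i (tnth u i) != 0 -> ~ dist_ball u ->
  B <= \sum_(i < d) h i (tnth u i).
Proof.
move=> gu /negP; rewrite -ltNge => uK.
have hi i : (tnth u i - tnth theta0 i) ^+ 2 <=
    h i (tnth u i) + 9 / 4 * tau ^+ 2 * (tnth theta0 i != 0)%:R.
  have : g i (tnth u i) != 0 by move/prodf_neq0 : gu; exact.
  rewrite /h /g; have [->|_] /= := eqVneq (tnth theta0 i) 0.
    by rewrite subr0 mulr0 addr0.
  rewrite mulf_eq0 negb_or => /andP[_]; rewrite indicE.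
  case: (boolP (_ \in _)); last by rewrite eqxx.
  rewrite inE/= in_itv/= => /andP[u1 u2] _.
  rewrite add0r mulr1 (_ : 9 / 4 * tau ^+ 2 = (3 / 2 * tau) ^+ 2); last by field.
  rewrite -[leLHS]real_normK ?num_real// ler_pXn2r ?nnegrE//.
    by rewrite ler_norml; apply/andP; split; lra.
  by rewrite mulr_ge0// ltW.
have : \sum_(i < d) (tnth u i - tnth theta0 i) ^+ 2 <= \sum_(i < d)
    (h i (tnth u i) + 9 / 4 * tau ^+ 2 * (tnth theta0 i != 0)%:R).
  by apply: ler_sum => i _; exact: hi.
rewrite big_split/= -mulr_sumr sum_supp /B; move: uK; lra.
Qed.

(** The arithmetic mean of [b] over the support is [2 + |theta0|_1 / (tau s)], and
    [2 s tau + |theta0|_1 <= C1] because [s <= d]. *)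
Let prod_b_le : \prod_(i < d | tnth theta0 i != 0) b i <= (C1 / (tau * s%:R)) ^+ s.
Proof.
have [agm _] := leif_AGM (A := [pred i | tnth theta0 i != 0]) (E := b)
  (fun i _ => ltW (b_gt0 i)).
apply: (le_trans agm); rewrite -/(norm0 theta0).
have s0 : 0 < s%:R :> R by rewrite ltr0n.
have sumb0 : 0 <= \sum_(i in [pred i | tnth theta0 i != 0]) b i.
  by apply: sumr_ge0 => i _; exact: ltW.
have le1 : (\sum_(i in [pred i | tnth theta0 i != 0]) b i) / s%:R <=
    C1 / (tau * s%:R).
  rewrite invfM mulrA ler_pM2r ?invr_gt0//.
  have -> : \sum_(i in [pred i | tnth theta0 i != 0]) b i =
      2 * s%:R + norm1 theta0 / tau.
    rewrite -sum_supp mulr_sumr /norm1 mulr_suml -big_split/= big_mkcond/=.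
    apply: eq_bigr => i _; rewrite inE /b; case: eqP => [->|_] /=.
      by rewrite normr0 mul0r mulr0 addr0.
    by rewrite mulr1.
  rewrite ler_pdivlMr// mulrDl divfK//.
  have : s%:R * tau <= d%:R * tau by rewrite ler_pM2r.
  by have := theta0_le; lra.
rewrite ler_pXn2r// nnegrE; last by apply: le_trans le1; rewrite divr_ge0.
by rewrite divr_ge0.
Qed.

Let I0_gt0 : 0 < I0.
Proof. by rewrite divr_gt0 ?pi_gt0// mulr_gt0// exprn_gt0. Qed.

Let x_gt0 : 0 < C1 / (tau * s%:R).
Proof.
rewrite divr_gt0//; last by rewrite mulr_gt0// ltr0n.
have : 0 <= norm1 theta0 by apply: sumr_ge0.
have : 0 < d%:R * tau by rewrite mulr_gt0// ltr0n (leq_trans s_gt0).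
by have := theta0_le; lra.
Qed.

(** On the support [J i = (6 / pi) * I0 * b i ^- 4], which is at least [3/2 * I0 * b i ^- 4] since
    [pi <= 4]. As [s >= 1], the resulting factor [(3/2)^s] exceeds [4/3] and pays for the [3/4] lost
    to Chebyshev's inequality. *)
Let prod_J_ge : (C1 / (tau * s%:R)) ^- (4 * s) * I0 ^+ d <=
  3 / 4 * \prod_(i < d) J i.
Proof.
have pi4 : pi <= 4 :> R.
  have [/andP[_]] := pihalf_02_cos_pihalf R.
  by lra.
pose r i := if tnth theta0 i == 0 then 1 else 3 / 2 * b i ^- 4.
have Jr i : I0 * r i <= J i.
  rewrite /J /r; case: eqP => _; first by rewrite mulr1.
  have b4 : 0 < b i ^+ 4 by exact: exprn_gt0.
  have t3 : 0 < tau ^+ 3 by exact: exprn_gt0.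
  rewrite (_ : I0 * _ = pi / 4 * (3 / (tau ^+ 3 * b i ^+ 4))).
    apply: ler_piMl; last lra.
    by rewrite divr_ge0// ltW// mulr_gt0.
  have bi0 : b i != 0 by rewrite gt_eqF.
  by rewrite /I0; move: (b i) bi0 => c c0; field; rewrite c0 tau0.
have r0 i : 0 <= r i.
  by rewrite /r; case: eqP => // _; rewrite mulr_ge0// invr_ge0 exprn_ge0// ltW.
have prod_r : \prod_(i < d) r i =
    (3 / 2) ^+ s * (\prod_(i < d | tnth theta0 i != 0) b i) ^- 4.
  rewrite -prodrXl -prodfV /norm0 -prodr_const -big_split/=.
  rewrite [RHS]big_mkcond/=; apply: eq_bigr => i _.
  by rewrite /r inE; case: eqP.
have : I0 ^+ d * \prod_(i < d) r i <= \prod_(i < d) J i.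
  rewrite -[X in I0 ^+ X]card_ord -prodr_const -big_split/=.
  by apply: ler_prod => i _; rewrite Jr mulr_ge0// ltW.
rewrite prod_r => leJ.
have P0 : 0 < \prod_(i < d | tnth theta0 i != 0) b i by apply: prodr_gt0.
have le4 : (C1 / (tau * s%:R)) ^- (4 * s) <=
    (\prod_(i < d | tnth theta0 i != 0) b i) ^- 4.
  rewrite lef_pV2 ?posrE ?exprn_gt0// mulnC exprM.
  by rewrite ler_pXn2r ?nnegrE ?exprn_ge0// ltW.
have le32 : 4 / 3 <= (3 / 2) ^+ s :> R.
  rewrite -(prednK s_gt0) exprS.
  have : 1 <= (3 / 2) ^+ s.-1 :> R by apply: exprn_ege1; lra.
  lra.
rewrite -ler_pdivrMl//; apply: le_trans leJ.
have I0d : 0 < I0 ^+ d by exact: exprn_gt0.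
set p := _ ^- 4 in le4 *; set q := _ ^- (4 * s) in le4 *.
have q0 : 0 <= q by rewrite invr_ge0 exprn_ge0// ltW.
rewrite mulrA mulrC ler_pM2l//.
apply: ler_pM => //; rewrite invf_div; lra.
Qed.

(** Dropping the truncation to the l1 ball leaves a product of [d] Student integrals. *)
Let integral_prior_weight_le :
  (\int[@lebesgue_tuple R d]_t (prior_weight t)%:E <= (I0 ^+ d)%:E)%E.
Proof.
rewrite lebE.
apply: (@le_trans _ _ (\int[tuple_measure leb d]_t (student_weight t)%:E)%E).
  have [M ->] := tuple_measure_sigma_finite leb d.
  apply: ge0_le_integral.
  - exact: measurableT.
  - by move=> t _; rewrite lee_fin prior_weight_ge0.
  - by apply/measurable_EFinP; exact: measurable_prior_weight.
  - by apply/measurable_EFinP; exact: measurable_student_weight.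
  - move=> t _; rewrite lee_fin /prior_weight indicE.
    by case: (_ \in _); rewrite ?mul1r// mul0r.
rewrite (integral_tuple_measure_prod leb
  (g := fun _ t => (tau ^+ 2 + t ^+ 2) ^- 2))//.
  under eq_bigr do rewrite lebI integral_student//.
  by rewrite prodEFin lee_fin prodr_const card_ord.
by move=> i t; rewrite invr_ge0 sqr_ge0.
Qed.

Lemma integral_prior_weight_lty :
  (\int[@lebesgue_tuple R d]_t (prior_weight t)%:E < +oo)%E.
Proof. exact: le_lt_trans integral_prior_weight_le (ltry _). Qed.

(** The ratio [3/4] comes from [B - \sum_i e i = (3 d - 5/4 s) tau^2], which is at least
    [3/4 * B = (3 d - 27/16 s) tau^2]. The truncation is invisible here, the ball being inside the
    l1 ball. *)
Let prod_J_le_mass : ((3 / 4 * \prod_(i < d) J i)%:E <=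
  \int[@lebesgue_tuple R d]_t (\1_dist_ball t * prior_weight t)%:E)%E.
Proof.
set X := (leRHS).
have := product_chebyshev mg mh g0 h0 gJ hJ measurable_dist_ball
  (ltW B_gt0) notin_dist_ball.
set Y := (\int[_]_u _)%E => chebyshev.
have YX : (Y <= X)%E.
  rewrite /X /Y lebE.
  have [M ->] := tuple_measure_sigma_finite leb d.
  apply: ge0_le_integral.
  - exact: measurableT.
  - by move=> u _; rewrite lee_fin mulr_ge0// prodr_ge0.
  - apply/measurable_EFinP; apply: measurable_funM.
      by apply: measurable_indic; exact: measurable_dist_ball.
    apply: measurable_prod => i _.
    by apply: (measurableT_comp (mg i)); exact: measurable_tnth.
  - apply/measurable_EFinP; apply: measurable_funM.
      by apply: measurable_indic; exact: measurable_dist_ball.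
    exact: measurable_prior_weight.
  - move=> u _; rewrite lee_fin !indicE.
    have [/set_mem uK|_] := boolP (u \in dist_ball); last by rewrite !mul0r.
    rewrite !mul1r /prior_weight indicE mem_set ?mul1r ?prodg_le//.
    exact: dist_ball_norm1.
apply: le_trans YX; rewrite -(@lee_pmul2l _ B%:E)//.
apply: le_trans chebyshev; rewrite -EFinM lee_fin mulrA ler_wpM2r//.
  apply: prodr_ge0 => i _.
  rewrite -lee_fin -gJ; apply: integral_ge0 => t _; rewrite lee_fin; exact: g0.
rewrite sum_e /B.
have : 0 <= s%:R * tau ^+ 2 by rewrite mulr_ge0 ?sqr_ge0.
lra.
Qed.

Lemma prior_mass_dist_ball :
  (((C1 / (tau * s%:R)) ^- (4 * s))%:E *
     \int[@lebesgue_tuple R d]_t (prior_weight t)%:E <=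
   \int[@lebesgue_tuple R d]_t (\1_dist_ball t * prior_weight t)%:E)%E.
Proof.
apply: le_trans prod_J_le_mass.
apply: (@le_trans _ _ ((C1 / (tau * s%:R)) ^- (4 * s) * I0 ^+ d)%:E).
  rewrite EFinM lee_wpmul2l// ?integral_prior_weight_le// lee_fin.
  by rewrite invr_ge0 exprn_ge0// ltW.
by rewrite lee_fin prod_J_ge.
Qed.

Lemma integral_prior_weight_gt0 :
  (0 < \int[@lebesgue_tuple R d]_t (prior_weight t)%:E)%E.
Proof.
have J_gt0 : (0 < (3 / 4 * \prod_(i < d) J i)%:E)%E.
  rewrite lte_fin mulr_gt0//; apply: prodr_gt0 => i _.
  rewrite /J; case: eqP => // _.
  by rewrite divr_gt0// mulr_gt0// exprn_gt0.
apply: (lt_le_trans J_gt0); apply: (le_trans prod_J_le_mass).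
rewrite lebE; have [M ->] := tuple_measure_sigma_finite leb d.
apply: ge0_le_integral.
- exact: measurableT.
- by move=> u _; rewrite lee_fin mulr_ge0// prior_weight_ge0.
- apply/measurable_EFinP; apply: measurable_funM.
    by apply: measurable_indic; exact: measurable_dist_ball.
  exact: measurable_prior_weight.
- by apply/measurable_EFinP; exact: measurable_prior_weight.
- move=> u _; rewrite lee_fin indicE.
  by case: (u \in _); rewrite ?mul1r// mul0r prior_weight_ge0.
Qed.

End prior_mass.

(** The integral of a nonnegative function is a supremum over the simple functions below it, hence
    monotone without measurability. This spares proving that posterior integrals are measurable in
    the data. *)
Lemma ge0_le_integral_nonmeasurable {dT} {T : measurableType dT} {R : realType}
    (m : {measure set T -> \bar R}) (f g : T -> \bar R) :
  (forall t, (0 <= f t)%E) -> (forall t, (f t <= g t)%E) ->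
  (\int[m]_t f t <= \int[m]_t g t)%E.
Proof.
move=> f0 fg; have g0 t : (0 <= g t)%E by exact: le_trans (fg t).
rewrite !ge0_integralTE//; apply: le_ereal_sup => _ [h /= hf <-].
by exists h => // t; exact: le_trans (fg t).
Qed.

Lemma prior_probability {R : realType} {d : nat} (theta0 : d.-tuple R)
    (tau C1 : R) :
  0 < tau -> (0 < norm0 theta0)%N -> norm1 theta0 <= C1 - 2 * d%:R * tau ->
  exists Pi : probability (d.-tuple R) R,
    prior tau C1 = Pi :> (set (d.-tuple R) -> \bar R) /\
    (((C1 / (tau * (norm0 theta0)%:R)) ^- (4 * norm0 theta0))%:E <=
      Pi (dist_ball theta0 tau))%E.
Proof.
move=> tau0 s0 t0_le.
have [leb [lebE _]] := @lebesgue_canonical R.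
have [M ME] := tuple_measure_sigma_finite leb d.
have LE : @lebesgue_tuple R d = M by rewrite lebE.
have mw := measurable_prior_weight (d := d) C1 tau0.
have w0 := prior_weight_ge0 (d := d) tau C1.
have := integral_prior_weight_gt0 tau0 s0 t0_le; rewrite LE => Zgt0.
have := integral_prior_weight_lty (d := d) C1 tau0; rewrite LE => Zlty.
have := prior_mass_dist_ball tau0 s0 t0_le; rewrite LE => mass.
have [Pi PiE] := normalized_density_probability mw w0 Zgt0 Zlty.
have priorE : prior tau C1 = Pi :> (set (d.-tuple R) -> \bar R).
  by rewrite -PiE /prior LE.
exists Pi; split => //.
rewrite -PiE /normalized_density.
have -> : (\int[M]_(t in dist_ball theta0 tau) (prior_weight tau C1 t)%:E =
    \int[M]_t (\1_(dist_ball theta0 tau) t * prior_weight tau C1 t)%:E)%E.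
  rewrite integral_mkcond; apply: eq_integral => t _.
  by rewrite patchE indicE; case: (_ \in _); rewrite ?mul1r ?mul0r.
have Zfin : (\int[M]_t (prior_weight tau C1 t)%:E)%E \is a fin_num.
  by rewrite ge0_fin_numE// ltW.
move: Zgt0 mass; rewrite -(fineK Zfin); set Z := fine _; set X := (\int[_]_u _)%E.
by rewrite lte_fin => Z0 mass; rewrite inver gt_eqF// lee_pdivlMr.
Qed.

(** * A PAC-Bayes bound for fractional posteriors *)

Section pac_bayes.
Local Open Scope ereal_scope.
Context {dT dS} {T : measurableType dT} {S : measurableType dS} {R : realType}.
Variables (P0 : probability T R) (Pi : probability S R) (n : nat).
Variables (q : S -> T -> R) (H : S -> R) (U : n.-tuple T -> R).
Hypothesis mq : measurable_fun setT (fun p : S * T => q p.1 p.2).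
Hypothesis q0 : forall t z, (0 <= q t z)%R.
Hypothesis HE : forall t, \int[P0]_z (q t z)%:E = (H t)%:E.
Hypotheses (H0 : forall t, (0 < H t)%R) (H1 : forall t, (H t <= 1)%R).
Hypotheses (mU : measurable_fun setT U) (U0 : forall z, (0 <= U z)%R).
Local Notation Q t z := (\prod_(i < n) q t (tnth z i))%R.
Hypothesis Q_ge : forall z, (expR (- U z))%:E <= \int[Pi]_t (Q t z)%:E.
Hypothesis Q_lty : forall z, \int[Pi]_t (Q t z)%:E < +oo.

Let Q0 t (z : n.-tuple T) : (0 <= Q t z)%R.
Proof. exact: prodr_ge0. Qed.

Let mQ : measurable_fun setT (fun p : n.-tuple T * S => Q p.2 p.1).
Proof.
apply: measurable_prod => i _.
apply: (measurableT_comp (f := fun p : S * T => q p.1 p.2)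
  (g := fun p : n.-tuple T * S => (p.2, tnth p.1 i)) mq).
apply/measurable_fun_pairP; split => //=; first exact: measurable_snd.
by apply: (measurableT_comp (measurable_tnth i)); exact: measurable_fst.
Qed.

Let mQz z : measurable_fun setT (fun t => Q t z).
Proof. exact: (measurableT_comp mQ (pair1_measurable z)). Qed.

Let mH : measurable_fun setT H.
Proof.
apply/measurable_EFinP.
rewrite (_ : EFin \o H = fubini_F P0 (fun p => (q p.1 p.2)%:E)).
  by apply: measurable_fun_fubini_tonelli_F => //; [exact/measurable_EFinP|
    move=> p; rewrite lee_fin].
by apply/funext => t; rewrite /fubini_F/= HE.
Qed.

Lemma measurable_oppr_ln : measurable_fun setT (fun t => - ln (H t))%R.
Proof.
apply: measurableT_comp => //.
exact: measurableT_comp (@measurable_ln R) mH.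
Qed.

Let mlnH : measurable_fun setT (fun t => n%:R * - ln (H t))%R.
Proof. by apply: measurable_funM => //; exact: measurable_oppr_ln. Qed.

Let mHn : measurable_fun setT (fun t => (H t ^- n))%R.
Proof.
have -> : (fun t => (H t ^- n))%R = (fun t => expR (n%:R * - ln (H t)))%R.
  apply/funext => t.
  by rewrite expRM_natl expRN lnK ?posrE// exprVn.
exact: measurableT_comp (@measurable_expR R) mlnH.
Qed.

Let lnH_ge0 t : (0 <= n%:R * - ln (H t))%R.
Proof. by rewrite mulr_ge0// oppr_ge0 ln_le0. Qed.

Let Hn_ge0 t : (0 <= H t ^- n)%R.
Proof. by rewrite invr_ge0 exprn_ge0// ltW. Qed.

Let A z := \int[Pi]_t (H t ^- n * Q t z)%:E.

Let A_ge0 z : 0 <= A z.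
Proof. by apply: integral_ge0 => t _; rewrite lee_fin mulr_ge0. Qed.

Let mHQ : measurable_fun setT
  (fun p : n.-tuple T * S => (H p.2 ^- n * Q p.2 p.1)%:E).
Proof.
apply/measurable_EFinP; apply: measurable_funM => //.
exact: (measurableT_comp mHn measurable_snd).
Qed.

Let mA : measurable_fun setT A.
Proof.
apply: (measurable_fun_fubini_tonelli_F
  (fun p : n.-tuple T * S => (H p.2 ^- n * Q p.2 p.1)%:E)) => //.
by move=> p; rewrite lee_fin mulr_ge0.
Qed.

(** After exchanging the integrals, independence gives [H t ^+ n] as the expectation of [Q t z] for
    fixed [t], which cancels [H t ^- n]. *)
Let integral_A : \int[tuple_measure P0 n]_z A z = 1.
Proof.
have [M ME] := tuple_measure_sigma_finite P0 n.
rewrite ME /A (fubini_tonelli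
  (fun p : n.-tuple T * S => (H p.2 ^- n * Q p.2 p.1)%:E))//=; last first.
  by move=> p; rewrite lee_fin mulr_ge0.
transitivity (\int[Pi]_t (cst 1%E t)); last first.
  by rewrite integral_cst// mul1e [LHS]probability_setT.
apply: eq_integral => t _ /=.
under eq_integral do rewrite EFinM.
have mqt : measurable_fun setT (q t).
  exact: (measurableT_comp mq (pair1_measurable t)).
transitivity ((H t ^- n)%:E * \int[tuple_measure P0 n]_z (Q t z)%:E).
  rewrite ME ge0_integralZl//.
  - apply/measurable_EFinP; apply: measurable_prod => i _.
    by apply: (measurableT_comp mqt); exact: measurable_tnth.
  - by move=> z _; rewrite lee_fin prodr_ge0.
  - by rewrite lee_fin.
have -> : \int[tuple_measure P0 n]_z (Q t z)%:E = \prod_(i < n) (H t)%:E.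
  rewrite (integral_tuple_measure_prod P0 (g := fun=> q t))//.
  by apply: eq_bigr => i _; exact: HE.
rewrite prodEFin -EFinM prodr_const card_ord mulVf//.
by rewrite gt_eqF// exprn_gt0.
Qed.

(* Fenchel-Young inequality for the exponential, [a + 1 <= exp (a - u) + u],
   at [a = - n log H]. *)
Let fenchel_young t z :
  (n%:R * - ln (H t) + 1 <= expR (- U z) * H t ^- n + U z)%R.
Proof.
have -> : (H t ^- n = expR (n%:R * - ln (H t)))%R.
  by rewrite expRM_natl expRN lnK ?posrE// exprVn.
rewrite -expRD -lerBlDr; apply: le_trans (expR_ge1Dx _).
by rewrite addrC addrA; lra.
Qed.

(** [fenchel_young] is multiplied by [Q t z], integrated over [t] and divided by the evidence [N];
    since [exp (- U z) <= N], the first term on the right becomes at most [A z]. The 1 stays on the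
    left to avoid subtracting from an infinite value. *)
Let posterior_le z :
  (\int[Pi]_t (n%:R * - ln (H t) * Q t z)%:E) / \int[Pi]_t (Q t z)%:E + 1 <=
  A z + (U z)%:E.
Proof.
have N_fin : \int[Pi]_t (Q t z)%:E \is a fin_num.
  by rewrite ge0_fin_numE//; apply: integral_ge0 => t _; rewrite lee_fin.
have := Q_ge z; rewrite -(fineK N_fin); set N := fine _ => QN.
have N0 : (0 < N)%R.
  by rewrite -lte_fin; apply: lt_le_trans QN; rewrite lte_fin expR_gt0.
have mQzE : measurable_fun setT (fun t => (Q t z)%:E).
  exact/measurable_EFinP.
have main : \int[Pi]_t (n%:R * - ln (H t) * Q t z)%:E + N%:E <=
    (expR (- U z))%:E * A z + (U z)%:E * N%:E.
  rewrite /N fineK// /A -!ge0_integralZl//; last 4 first.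
  - by move=> t _; rewrite lee_fin.
  - by rewrite lee_fin.
  - by apply/measurable_EFinP; apply: measurable_funM.
  - by move=> t _; rewrite lee_fin mulr_ge0.
  rewrite -!ge0_integralD//; last 7 first.
  - by move=> t _; rewrite -EFinM lee_fin !mulr_ge0// expR_ge0.
  - apply: measurable_funeM; apply/measurable_EFinP.
    exact: measurable_funM.
  - by move=> t _; rewrite -EFinM lee_fin mulr_ge0.
  - by apply: measurable_funeM.
  - by move=> t _; rewrite lee_fin mulr_ge0.
  - by apply/measurable_EFinP; apply: measurable_funM.
  - by move=> t _; rewrite lee_fin.
  apply: ge0_le_integral_nonmeasurable => t.
    by rewrite adde_ge0// lee_fin// mulr_ge0.
  rewrite -!EFinM -!EFinD lee_fin mulrA -mulrDl -[X in (_ + X)%R]mul1r -mulrDl.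
  by rewrite ler_wpM2r// fenchel_young.
have X0 : 0 <= \int[Pi]_t (n%:R * - ln (H t) * Q t z)%:E.
  by apply: integral_ge0 => t _; rewrite lee_fin mulr_ge0.
(* An infinite [A z] makes the bound trivial; otherwise [main] forces [X] to be finite and the rest
   is real arithmetic. *)
have [A_lty|] := ltP (A z) +oo; last first.
  by rewrite leye_eq => /eqP ->; rewrite addye// leey.
have A_fin : A z \is a fin_num by rewrite ge0_fin_numE.
move: main; rewrite -(fineK A_fin); set a := fine (A z).
have a0 : (0 <= a)%R by exact: fine_ge0.
move: X0; set X := integral _ _ _ => X0 main.
have X_fin : X \is a fin_num.
  rewrite ge0_fin_numE//; apply: (@le_lt_trans _ _ (X + N%:E)).
    by rewrite leeDl// lee_fin ltW.
  by apply: (le_lt_trans main); rewrite -!EFinM -EFinD ltry.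
move: main X0; rewrite -(fineK X_fin) -!EFinM -!EFinD inver gt_eqF//.
rewrite -EFinM -EFinD !lee_fin => main x0.
rewrite -lerBrDr ler_pdivrMr//.
have : (expR (- U z) * a <= N * a)%R by rewrite ler_wpM2r// -lee_fin.
move: main; nra.
Qed.

(** The posterior integral is bounded by the measurable function [Psi = A + U - 1], whose
    expectation is that of [U] because [A] has expectation 1. *)
Lemma pac_bayes (c : R) : (0 <= c)%R ->
  \int[tuple_measure P0 n]_z (c%:E *
    ((\int[Pi]_t (n%:R * - ln (H t) * Q t z)%:E) / \int[Pi]_t (Q t z)%:E)) <=
  c%:E * \int[tuple_measure P0 n]_z (U z)%:E.
Proof.
move=> c0.
have [M ME] := tuple_measure_sigma_finite P0 n; rewrite ME.
pose F z :=
  (\int[Pi]_t (n%:R * - ln (H t) * Q t z)%:E) / \int[Pi]_t (Q t z)%:E.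
have F0 z : 0 <= F z.
  rewrite /F mule_ge0 ?inve_ge0 ?integral_ge0// => t _; rewrite lee_fin//.
  by rewrite mulr_ge0.
pose Psi z := A z + (U z)%:E - 1.
have FPsi z : F z <= Psi z.
  by rewrite leeBrDr//; exact: posterior_le.
have Psi0 z : 0 <= Psi z by exact: le_trans (FPsi z).
have mUE : measurable_fun setT (EFin \o U) by exact/measurable_EFinP.
have mPsi : measurable_fun setT Psi.
  by apply: emeasurable_funB => //; exact: emeasurable_funD.
apply: (@le_trans _ _ (\int[M]_z (c%:E * Psi z))).
  apply: ge0_le_integral_nonmeasurable => z; first by apply: mule_ge0 => //; exact: F0.
  by apply: lee_wpmul2l; [by []|exact: FPsi].
rewrite ge0_integralZl//; apply: lee_wpmul2l => //.
have M1 : M setT = 1 by rewrite -ME; exact: tuple_measure_setT.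
(* Adding 1 on both sides keeps every integrand nonnegative, so additivity holds even if [U] has
   infinite expectation. *)
have : \int[M]_z (Psi z + 1) = \int[M]_z (A z + (U z)%:E).
  by apply: eq_integral => z _; rewrite /Psi subeK.
rewrite ge0_integralD// [in RHS]ge0_integralD//; last first.
  by move=> z _; rewrite lee_fin; exact: U0.
have -> : \int[M]_z A z = 1 by rewrite -ME integral_A.
rewrite integral_cst// mul1e.
rewrite [X in _ + X = _]M1 [RHS]addeC.
by move=> /(congr1 (fun x => x - 1)); rewrite !addeK// => ->.
Qed.

End pac_bayes.

(** * The logistic model *)

Section logit_ratio.
Context {R : realType} {d : nat}.
Implicit Types (t x : d.-tuple R) (z : bool * d.-tuple R).

Definition sigmoid (a : R) : R := expR a / (1 + expR a).

Lemma sigmoid_gt0 a : 0 < sigmoid a.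
Proof. by rewrite divr_gt0 ?addr_gt0 ?expR_gt0. Qed.

Lemma sigmoid_le1 a : sigmoid a <= 1.
Proof.
by rewrite ler_pdivrMr ?addr_gt0 ?expR_gt0// mul1r lerDr.
Qed.

Lemma continuous_sigmoid : continuous sigmoid.
Proof.
move=> a; apply: cvgM; first exact: continuous_expR.
apply: cvgV; first by rewrite gt_eqF// addr_gt0 ?expR_gt0.
by apply: cvgD; [exact: cvg_cst|exact: continuous_expR].
Qed.

(** The logarithm of [sigmoid] is 1-Lipschitz. For [a <= b] the ratio is [exp (a - b)] times
    [(1 + exp b) / (1 + exp a) >= 1]; for [b <= a] monotonicity makes it at least 1. *)
Lemma sigmoid_ratio_ge (a b : R) : expR (- `|a - b|) <= sigmoid a / sigmoid b.
Proof.
have ea := expR_gt0 a; have eb := expR_gt0 b.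
rewrite ler_pdivlMr ?sigmoid_gt0//; have [ab|/ltW ba] := leP a b.
  rewrite ler0_norm ?subr_le0// opprK /sigmoid mulrA -expRD subrK.
  by rewrite ler_pM2l// lef_pV2 ?posrE ?addr_gt0// lerD2l ler_expR.
apply: (@le_trans _ _ (sigmoid b)).
  apply: ler_piMl; first exact/ltW/sigmoid_gt0.
  by rewrite -[leRHS]expR0 ler_expR oppr_le0.
rewrite /sigmoid ler_pdivrMr ?addr_gt0// mulrAC ler_pdivlMr ?addr_gt0//.
by rewrite !mulrDr !mulr1 [expR b * _]mulrC lerD2r ler_expR.
Qed.


Definition logit_ratio theta0 t z : R :=
  logit_pmf t z.1 z.2 / logit_pmf theta0 z.1 z.2.

Lemma logit_pmfE t y x : logit_pmf t y x = sigmoid (label y * dot x t).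
Proof. by []. Qed.

Lemma logit_pmf_gt0 t y x : 0 < logit_pmf t y x.
Proof. by rewrite logit_pmfE sigmoid_gt0. Qed.

Lemma logit_ratio_gt0 theta0 t z : 0 < logit_ratio theta0 t z.
Proof. by rewrite divr_gt0 ?logit_pmf_gt0. Qed.

Let measurable_logit :
  measurable_fun setT (fun p : d.-tuple R * (bool * d.-tuple R) =>
    label p.2.1 * dot p.2.2 p.1).
Proof.
apply: measurable_funM.
  (* Every set of booleans is measurable. *)
  have ml : measurable_fun setT (@label R) by move=> _ Y _; exact: I.
  apply: (measurableT_comp ml).
  by apply: (measurableT_comp measurable_fst); exact: measurable_snd.
apply: measurable_sum => i; apply: measurable_funM.
  apply: (measurableT_comp (measurable_tnth i)).
  by apply: (measurableT_comp measurable_snd); exact: measurable_snd.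
by apply: (measurableT_comp (measurable_tnth i)); exact: measurable_fst.
Qed.

Lemma measurable_logit_pmf_pair :
  measurable_fun setT (fun p : d.-tuple R * (bool * d.-tuple R) =>
    logit_pmf p.1 p.2.1 p.2.2).
Proof.
have ms : measurable_fun setT sigmoid.
  by apply: continuous_measurable_fun; exact: continuous_sigmoid.
exact: (measurableT_comp ms measurable_logit).
Qed.

Lemma measurable_logit_ratio_pair theta0 :
  measurable_fun setT (fun p : d.-tuple R * (bool * d.-tuple R) =>
    logit_ratio theta0 p.1 p.2).
Proof.
apply: measurable_funM; first exact: measurable_logit_pmf_pair.
have mV : measurable_fun setT (fun a : R => (sigmoid a)^-1).
  apply: continuous_measurable_fun => a.
  by apply: cvgV; [rewrite gt_eqF// sigmoid_gt0|exact: continuous_sigmoid].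
apply: (measurableT_comp mV).
apply: (measurableT_comp (measurableT_comp measurable_logit
  (pair1_measurable theta0))).
exact: measurable_snd.
Qed.

Lemma measurable_logit_ratio theta0 t :
  measurable_fun setT (logit_ratio theta0 t).
Proof.
exact: (measurableT_comp (measurable_logit_ratio_pair theta0) (pair1_measurable t)).
Qed.

End logit_ratio.

(** * The Rényi divergence of two logistic laws *)

Section renyi.
Local Open Scope ereal_scope.
Context {R : realType} {d : nat}.
Variables (mu : probability (d.-tuple R) R) (theta0 : d.-tuple R).
Local Notation P t := (logit_law mu t : probability (bool * d.-tuple R)%type R).

(** Both laws have the same marginal [mu], so the ratio of the conditional mass functions is a
    density of one with respect to the other. *)
Lemma logit_law_density t A : measurable A ->
  logit_law mu t A =
  \int[logit_law mu theta0]_(z in A) (logit_ratio theta0 t z)%:E.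
Proof.
move=> mA.
rewrite integral_mkcond integral_logit_law.
- rewrite /logit_law; apply: eq_bigr => y _.
  rewrite integral_mkcond; apply: eq_integral => x _.
  rewrite !patchE mem_xsection; case: ifPn => _; last by rewrite mul0e.
  rewrite -EFinM /logit_ratio/= divfK// gt_eqF//; exact: logit_pmf_gt0.
- apply/(measurable_restrictT _ mA)/measurable_funTS.
  by apply/measurable_EFinP; exact: measurable_logit_ratio.
- move=> z; rewrite patchE; case: ifP => // _.
  by rewrite lee_fin ltW// logit_ratio_gt0.
Qed.

Variable nu : {sigma_finite_measure set (bool * d.-tuple R)%type -> \bar R}.
Hypothesis Pnu : forall t, P t `<< nu.
Variable alpha : R.
Hypotheses (alpha0 : (0 < alpha)%R) (alpha1 : (alpha < 1)%R).

Let q := Radon_Nikodym (charge_of_finite_measure (P theta0)) nu.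

Let ratio_integrable t :
  (P theta0).-integrable setT (EFin \o logit_ratio theta0 t).
Proof.
apply/integrableP; split.
  by apply/measurable_EFinP; exact: measurable_logit_ratio.
under eq_integral do rewrite /= gtr0_norm ?logit_ratio_gt0//.
by rewrite -logit_law_density// [ltLHS]probability_setT ltry.
Qed.

(** [Radon_Nikodym] differentiates a charge; its sign is obtained almost everywhere, from its
    agreement with the nonnegative derivative of a measure. *)
Let q_ge0 : ae_eq nu setT q (fun z => `|q z|).
Proof.
have := ae_eq_Radon_Nikodym_SigmaFinite (Pnu theta0) measurableT.
apply: filterS => z /= + _ => /(_ Logic.I) qz.
rewrite /q -qz gee0_abs//.
exact: (Radon_Nikodym_SigmaFinite.f_ge0 (Pnu theta0)).
Qed.

(** Chain rule for densities: both sides have the same integral over every measurable set. *)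
Let density_chain t :
  ae_eq nu setT (Radon_Nikodym (charge_of_finite_measure (P t)) nu)
    (fun z => (logit_ratio theta0 t z)%:E * q z).
Proof.
apply: integral_ae_eq => //.
- by apply: Radon_Nikodym_integrable; exact: Pnu.
- apply: emeasurable_funM.
    by apply/measurable_EFinP; exact: measurable_logit_ratio.
  apply: (measurable_int nu); apply: Radon_Nikodym_integrable.
  exact: (Pnu theta0).
- move=> A _ mA; rewrite -Radon_Nikodym_integral//; last exact: Pnu.
  have r_int := integrableS measurableT mA (@subsetT _ A) (ratio_integrable t).
  rewrite (Radon_Nikodym_change_of_variables (Pnu theta0) mA r_int).
  exact: logit_law_density.
Qed.

Let measurable_powR_ratio t :
  measurable_fun setT (fun z => (logit_ratio theta0 t z `^ alpha)%:E).
Proof.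
apply/measurable_EFinP.
exact: (measurableT_comp (measurable_powR alpha) (measurable_logit_ratio _ _)).
Qed.

(* Convexity of the exponential: both values [expR c] and [1] lie above the
   tangent line at [alpha * c]. *)
Let powR_le (r : R) : (0 < r -> r `^ alpha <= (1 - alpha) + alpha * r)%R.
Proof.
move=> r0; rewrite /powR gt_eqF//; set c := ln r.
have h0 : (expR (alpha * c) * (1 - alpha * c) <= 1)%R.
  have -> : 1%R = (expR (alpha * c) * expR (- (alpha * c)))%R :> R.
    by rewrite -expRD subrr expR0.
  rewrite ler_pM2l ?expR_gt0//; apply: le_trans (expR_ge1Dx _).
  by rewrite -expRD subrr expR0.
have h1 : (expR (alpha * c) * (1 + (c - alpha * c)) <= r)%R.
  have -> : r = (expR (alpha * c) * expR (c - alpha * c))%R.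
    by rewrite -expRD subrKC lnK// posrE.
  by rewrite ler_pM2l ?expR_gt0// expR_ge1Dx.
move: alpha0 alpha1 h0 h1; set E := expR _; nra.
Qed.

(** Integrate [powR_le]: the likelihood ratio has mean 1 under [P theta0]. *)
Lemma integral_powR_ratio_le t :
  \int[P theta0]_z (logit_ratio theta0 t z `^ alpha)%:E <= 1.
Proof.
have mr := measurable_logit_ratio theta0 t.
have r0 z := logit_ratio_gt0 theta0 t z.
apply: (@le_trans _ _ (\int[P theta0]_z
    ((1 - alpha)%:E + alpha%:E * (logit_ratio theta0 t z)%:E))).
  apply: ge0_le_integral_nonmeasurable => z; first by rewrite lee_fin powR_ge0.
  by rewrite -EFinM -EFinD lee_fin powR_le.
have a0 : (0 <= 1 - alpha)%R by rewrite subr_ge0 ltW.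
rewrite ge0_integralD//; last 2 first.
- by move=> z _; rewrite -EFinM lee_fin mulr_ge0// ltW.
- by apply: measurable_funeM; exact/measurable_EFinP.
rewrite ge0_integralZl//; last 3 first.
- exact/measurable_EFinP.
- by move=> z _; rewrite lee_fin ltW.
- by rewrite lee_fin ltW.
rewrite integral_cst// [X in _ * X]probability_setT mule1.
rewrite -logit_law_density// [X in _ + _ * X]probability_setT mule1.
by rewrite -EFinD subrK.
Qed.

Let powR_integrable t :
  (P theta0).-integrable setT (fun z => (logit_ratio theta0 t z `^ alpha)%:E).
Proof.
apply/integrableP; split; first exact: measurable_powR_ratio.
apply: le_lt_trans (ltry 1); apply: le_trans (integral_powR_ratio_le t).
rewrite le_eqVlt; apply/orP; left; apply/eqP; apply: eq_integral => z _ /=.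
by rewrite ger0_norm// powR_ge0.
Qed.

(** By [density_chain], [p^alpha q^(1 - alpha) = r^alpha q] almost everywhere, with [r] the
    likelihood ratio; the dominating measure [nu] thus disappears. *)
Lemma renyi_logit_law t :
  renyi nu alpha (P t) (P theta0) =
  ((alpha - 1)^-1)%:E *
    lne (\int[P theta0]_z (logit_ratio theta0 t z `^ alpha)%:E).
Proof.
rewrite /renyi; congr (_ * lne _).
rewrite -(Radon_Nikodym_change_of_variables (Pnu theta0) measurableT
  (powR_integrable t)) -/q.
have mRN t' : measurable_fun setT
    (Radon_Nikodym (charge_of_finite_measure (P t')) nu).
  by apply: (measurable_int nu); apply: Radon_Nikodym_integrable; exact: Pnu.
apply: ae_eq_integral => //.
- apply: emeasurable_funM.
    exact: (measurableT_comp (measurable_poweR alpha) (mRN t)).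
  exact: (measurableT_comp (measurable_poweR (1 - alpha)) (mRN theta0)).
- by apply: emeasurable_funM => //; exact: mRN.
have := density_chain t; have := q_ge0; apply: filterS2 => z /= qz pz _.
rewrite pz// -/q; move: (qz Logic.I) => {}qz.
have : q z \is a fin_num by apply: Radon_Nikodym_fin_num; exact: Pnu.
move: (q z) qz => [c| |]// qz _.
have c0 : (0 <= c)%R by rewrite -lee_fin qz abse_ge0.
rewrite -!EFinM; congr EFin.
rewrite powRM// ?(ltW (logit_ratio_gt0 _ _ _))// -mulrA -powRD.
  by rewrite subrKC powRr1.
by rewrite subrKC oner_eq0.
Qed.

End renyi.

Section tuple_sum.
Local Open Scope ereal_scope.
Context {dT} {T : measurableType dT} {R : realType}.

(** A function of one coordinate is a product whose other factors are 1, so each summand integrates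
    as under [p]. *)
Lemma integral_tuple_measure_sum (p : probability T R) n (g : T -> R) :
  measurable_fun setT g -> (forall x, (0 <= g x)%R) ->
  \int[tuple_measure p n]_u (\sum_(i < n) g (tnth u i))%:E =
  \sum_(i < n) \int[p]_x (g x)%:E.
Proof.
move=> mg g0.
have coord j : \int[tuple_measure p n]_u (g (tnth u j))%:E = \int[p]_x (g x)%:E.
  pose k (i : 'I_n) x := if i == j then g x else 1%R.
  transitivity (\int[tuple_measure p n]_u (\prod_(i < n) k i (tnth u i))%:E).
    have [M ->] := tuple_measure_sigma_finite p n.
    apply: eq_integral => u _; congr EFin.
    rewrite (bigD1 j)//= {1}/k eqxx big1 ?mulr1// => i /negbTE ij.
    by rewrite /k ij.
  rewrite integral_tuple_measure_prod.
  - rewrite (bigD1 j)//= {1}/k eqxx big1 ?mule1// => i /negbTE ij.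
    by rewrite /k ij integral_cst// mul1e; exact: probability_setT.
  - by move=> i; rewrite /k; case: eqP.
  - by move=> i x; rewrite /k; case: eqP.
under [RHS]eq_bigr => j _ do rewrite -(coord j).
have [M ->] := tuple_measure_sigma_finite p n.
under eq_integral do rewrite -sumEFin.
rewrite ge0_integral_sum//.
- move=> j; apply/measurable_EFinP.
  by apply: (measurableT_comp mg); exact: measurable_tnth.
- by move=> j u _; rewrite lee_fin.
Qed.

End tuple_sum.

Section logit_model_bounds.
Context {R : realType} {d : nat}.
Implicit Types (t x : d.-tuple R).

Lemma norm2_ge0 x : 0 <= norm2 x.
Proof. exact: sqrtr_ge0. Qed.

Lemma measurable_norm2 : measurable_fun setT (@norm2 R d).
Proof.
apply: (@measurableT_comp _ _ _ _ _ _ (@Num.sqrt R)).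
  by apply: continuous_measurable_fun; exact: sqrt_continuous.
apply: measurable_sum => i.
by apply: measurable_funX; exact: measurable_tnth.
Qed.

(** Cauchy-Schwarz, obtained termwise from [u v <= m / (2 X) u^2 + X / (2 m) v^2] with [X] the norm
    of [x] and [m] the radius; [X = 0] is treated apart. *)
Lemma dot_dist_ball theta0 t x (tau : R) : 0 < tau -> (0 < d)%N ->
  dist_ball theta0 tau t ->
  `|dot x t - dot x theta0| <= norm2 x * (2 * Num.sqrt d%:R * tau).
Proof.
move=> tau0 d0; rewrite /dist_ball/=.
have dR0 : 0 < Num.sqrt d%:R :> R by rewrite sqrtr_gt0 ltr0n.
have -> : 4 * d%:R * tau ^+ 2 = (2 * Num.sqrt d%:R * tau) ^+ 2.
  by rewrite !exprMn sqr_sqrtr// -natrX.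
set m := 2 * _ * _; have m0 : 0 < m by rewrite !mulr_gt0.
move=> um.
have -> : dot x t - dot x theta0 =
    \sum_(i < d) tnth x i * (tnth t i - tnth theta0 i).
  by rewrite /dot -sumrB; apply: eq_bigr => i _; rewrite mulrBr.
have sx0 : 0 <= \sum_(i < d) tnth x i ^+ 2 by apply: sumr_ge0 => i _; exact: sqr_ge0.
have X2 : norm2 x ^+ 2 = \sum_(i < d) tnth x i ^+ 2 by rewrite sqr_sqrtr.
have [X0|X_gt0] := eqVneq (norm2 x) 0.
  rewrite big1 ?normr0 ?X0 ?mul0r// => i _.
  have : \sum_(i < d) tnth x i ^+ 2 = 0 by rewrite -X2 X0 expr0n.
  move/eqP; rewrite psumr_eq0; last by move=> j _; exact: sqr_ge0.
  by move/allP/(_ i (mem_index_enum _)); rewrite sqrf_eq0 => /eqP ->; rewrite mul0r.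
have {}X_gt0 : 0 < norm2 x by rewrite lt_def X_gt0 norm2_ge0.
apply: (le_trans (ler_norm_sum _ _ _)).
set X := norm2 x in X2 X_gt0 *.
apply: (@le_trans _ _ (\sum_(i < d) (m / (2 * X) * tnth x i ^+ 2 +
    X / (2 * m) * (tnth t i - tnth theta0 i) ^+ 2))).
  apply: ler_sum => i _; rewrite normrM.
  rewrite -[tnth x i ^+ 2]real_normK ?num_real//.
  rewrite -[(tnth t i - _) ^+ 2]real_normK ?num_real//.
  set u := `|tnth x i|; set v := `|_ - _|; rewrite -subr_ge0.
  have -> : m / (2 * X) * u ^+ 2 + X / (2 * m) * v ^+ 2 - u * v =
      (m * u - X * v) ^+ 2 / (2 * X * m).
    by field; rewrite !gt_eqF.
  by rewrite divr_ge0 ?sqr_ge0// !mulr_ge0// ltW.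
rewrite big_split/= -!mulr_sumr -X2.
apply: (@le_trans _ _ (m / (2 * X) * X ^+ 2 + X / (2 * m) * m ^+ 2)).
  by rewrite lerD2l ler_wpM2l// ltW// divr_gt0// mulr_gt0.
rewrite le_eqVlt; apply/orP; left; apply/eqP.
by field; rewrite !gt_eqF.
Qed.

Lemma norm_label (y : bool) : `|label y| = 1 :> R.
Proof. by case: y; rewrite /label ?normrN normr1. Qed.

Lemma logit_ratio_ge theta0 t z (delta : R) :
  `|dot z.2 t - dot z.2 theta0| <= delta ->
  expR (- delta) <= logit_ratio theta0 t z.
Proof.
move=> le_delta; rewrite /logit_ratio !logit_pmfE.
apply: le_trans (sigmoid_ratio_ge _ _).
by rewrite ler_expR lerN2 -mulrBr normrM norm_label mul1r.
Qed.

Lemma powR_expR (a p : R) : expR a `^ p = expR (p * a).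
Proof. by rewrite /powR gt_eqF ?expR_gt0// expRK. Qed.

Lemma powR_prod (I : Type) (r : seq I) (F : I -> R) (p : R) :
  (forall i, 0 <= F i) ->
  (\prod_(i <- r) F i) `^ p = \prod_(i <- r) F i `^ p.
Proof.
move=> F0; elim: r => [|i r IH]; first by rewrite !big_nil powR1.
by rewrite !big_cons powRM ?IH// prodr_ge0.
Qed.

(** The first factor does not depend on [t], so it cancels when the posterior is normalized. *)
Lemma likelihood_ratio n (z : n.-tuple (bool * d.-tuple R)) theta0 t (p : R) :
  likelihood z t `^ p =
  likelihood z theta0 `^ p * \prod_(i < n) logit_ratio theta0 t (tnth z i) `^ p.
Proof.
have L0 t' : 0 <= likelihood z t'.
  by apply: prodr_ge0 => i _; exact: logit_pmf_ge0.
have r0 i : 0 <= logit_ratio theta0 t (tnth z i).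
  exact/ltW/logit_ratio_gt0.
rewrite -powR_prod// -powRM//; last exact: prodr_ge0.
congr (_ `^ _); rewrite /likelihood -big_split/=; apply: eq_bigr => i _.
by rewrite /logit_ratio mulrCA divff ?mulr1// gt_eqF// logit_pmf_gt0.
Qed.

Lemma likelihood_gt0 n (z : n.-tuple (bool * d.-tuple R)) t : 0 < likelihood z t.
Proof. by apply: prodr_gt0 => i _; exact: logit_pmf_gt0. Qed.

Lemma integral_logit_law_norm2 (mu : probability (d.-tuple R) R) theta0 :
  (\int[logit_law mu theta0]_z (norm2 z.2)%:E = \int[mu]_x (norm2 x)%:E)%E.
Proof.
have mn := measurable_norm2.
rewrite integral_logit_law.
- rewrite -ge0_integral_sum//.
  + apply: eq_integral => x _ /=.
    under eq_bigr do rewrite -EFinM.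
    by rewrite sumEFin -mulr_sumr logit_pmf_sum mulr1.
  + move=> y; apply/measurable_EFinP; apply: measurable_funM => //.
    exact: measurable_logit_pmf.
  + by move=> y x _; rewrite lee_fin mulr_ge0 ?norm2_ge0 ?logit_pmf_ge0.
- apply/measurable_EFinP; exact: (measurableT_comp mn measurable_snd).
- by move=> z; rewrite lee_fin norm2_ge0.
Qed.

(** From [r <= 1 + r^2], [mu] having mass 1. *)
Lemma integral_norm2_lty (mu : probability (d.-tuple R) R) :
  ('E_mu[(fun x => norm2 x ^+ 2)%R] < +oo)%E ->
  (\int[mu]_x (norm2 x)%:E < +oo)%E.
Proof.
rewrite unlock => lty; have mn := measurable_norm2.
apply: (@le_lt_trans _ _ (\int[mu]_x (1%:E + (norm2 x ^+ 2)%:E))%E).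
  apply: ge0_le_integral_nonmeasurable => x; first by rewrite lee_fin norm2_ge0.
  rewrite -EFinD lee_fin; have := sqr_ge0 (norm2 x - 1); have := norm2_ge0 x.
  rewrite sqrrB1; lra.
rewrite ge0_integralD//.
- rewrite integral_cst// mul1e [X in (X + _)%E]probability_setT.
  by apply: lte_add_pinfty => //; exact: ltry.
- by move=> x _; rewrite lee_fin sqr_ge0.
- by apply/measurable_EFinP; exact: measurable_funX.
Qed.

End logit_model_bounds.

(** * The Hellinger integral and the posterior mean of the divergence *)

Section fractional_posterior.
Local Open Scope ereal_scope.
Context {R : realType} {d : nat}.
Variables (mu : probability (d.-tuple R) R) (theta0 : d.-tuple R) (alpha : R).
Hypotheses (alpha0 : (0 < alpha)%R) (alpha1 : (alpha < 1)%R).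
Local Notation P t := (logit_law mu t : probability (bool * d.-tuple R)%type R).

Definition hellinger t : R :=
  fine (\int[P theta0]_z (logit_ratio theta0 t z `^ alpha)%:E).

Lemma hellingerE t :
  \int[P theta0]_z (logit_ratio theta0 t z `^ alpha)%:E = (hellinger t)%:E.
Proof.
rewrite fineK// ge0_fin_numE; last first.
  by apply: integral_ge0 => z _; rewrite lee_fin powR_ge0.
by apply: le_lt_trans (ltry 1); exact: integral_powR_ratio_le.
Qed.

Lemma hellinger_le1 t : (hellinger t <= 1)%R.
Proof. by rewrite -lee_fin -hellingerE; exact: integral_powR_ratio_le. Qed.

Lemma measurable_powR_ratio_pair :
  measurable_fun setT (fun p : d.-tuple R * (bool * d.-tuple R) =>
    logit_ratio theta0 p.1 p.2 `^ alpha)%R.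
Proof.
exact: (measurableT_comp (measurable_powR alpha)
  (measurable_logit_ratio_pair theta0)).
Qed.

(** Were it zero, a positive function would vanish almost everywhere, and the whole space would be a
    null set. *)
Lemma hellinger_gt0 t : (0 < hellinger t)%R.
Proof.
have q0 z : (0 < logit_ratio theta0 t z `^ alpha)%R.
  by rewrite powR_gt0// logit_ratio_gt0.
have mq : measurable_fun setT
    (fun z : bool * d.-tuple R => (logit_ratio theta0 t z `^ alpha)%:E).
  apply/measurable_EFinP.
  exact: (measurableT_comp measurable_powR_ratio_pair (pair1_measurable t)).
rewrite lt_def; apply/andP; split; last first.
  rewrite -lee_fin -hellingerE; apply: integral_ge0 => z _.
  by rewrite lee_fin ltW.
apply/eqP => h0.
have : \int[P theta0]_z `|(logit_ratio theta0 t z `^ alpha)%:E| = 0.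
  rewrite -[RHS]/(0%R%:E) -h0 -hellingerE; apply: eq_integral => z _.
  by rewrite gee0_abs// lee_fin ltW.
move=> /(ae_eq_integral_abs _ measurableT mq) [N [mN N0 sub]].
have NT : N = setT.
  apply/seteqP; split => // z _; apply: sub => /= /(_ Logic.I)[] /eqP.
  by rewrite gt_eqF.
have := @probability_setT _ _ _ (P theta0); rewrite -NT N0 => /eqP.
by rewrite lt_eqF// lte01.
Qed.

(** The divergence is [- ln (hellinger t) / (1 - alpha)]; the factor [n] is inserted to match the
    form bounded in [pac_bayes]. *)
Lemma integral_fractional_posterior_renyi n
    (nu : {sigma_finite_measure set (bool * d.-tuple R)%type -> \bar R})
    (Pi : probability (d.-tuple R) R) (z : n.-tuple (bool * d.-tuple R)) :
  (forall t, P t `<< nu) -> (0 < n)%N ->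
  let Q t := (\prod_(i < n) (logit_ratio theta0 t (tnth z i) `^ alpha))%R in
  0 < \int[Pi]_t (Q t)%:E < +oo ->
  \int[fractional_posterior alpha Pi z]_t renyi nu alpha (P t) (P theta0) =
  (((1 - alpha) * n%:R)^-1)%:E *
    ((\int[Pi]_t (n%:R * - ln (hellinger t) * Q t)%:E) / \int[Pi]_t (Q t)%:E).
Proof.
move=> Pnu n0 Q /andP[N_gt0 N_lty].
set c := ((1 - alpha) * n%:R)^-1%R.
have nR : (n%:R != 0 :> R)%R by rewrite pnatr_eq0 -lt0n.
have a1 : (1 - alpha != 0)%R by rewrite subr_eq0 gt_eqF.
have c0 : (0 <= c)%R by rewrite invr_ge0 mulr_ge0// subr_ge0 ltW.
have renyiE t : renyi nu alpha (P t) (P theta0) =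
    (c * (n%:R * - ln (hellinger t)))%:E.
  rewrite renyi_logit_law// hellingerE lne_EFin ?hellinger_gt0// -EFinM.
  congr EFin; rewrite /c -opprB invrN.
  by field; rewrite nR a1.
have -> : (fun t => renyi nu alpha (P t) (P theta0)) =
    (fun t => (c * (n%:R * - ln (hellinger t)))%:E) by exact/funext.
set L := (likelihood z theta0 `^ alpha)%R.
have L0 : (0 < L)%R by rewrite powR_gt0// likelihood_gt0.
have vE : (fun t => likelihood z t `^ alpha)%R = (fun t => L * Q t)%R.
  by apply/funext => t; exact: likelihood_ratio.
have Q0 t : (0 <= Q t)%R by apply: prodr_ge0 => i _; exact: powR_ge0.
have mQ : measurable_fun setT Q.
  apply: measurable_prod => i _.
  exact: (measurableT_comp measurable_powR_ratio_pair
    (pair2_measurable (tnth z i))).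
have mln : measurable_fun setT (fun t => - ln (hellinger t))%R.
  exact: (measurable_oppr_ln (P0 := P theta0)
    (q := fun t z => (logit_ratio theta0 t z `^ alpha)%R)
    measurable_powR_ratio_pair (fun t z => powR_ge0 _ _) hellingerE).
have ln0 t : (0 <= - ln (hellinger t))%R.
  by rewrite oppr_ge0 ln_le0// hellinger_le1.
have mv : measurable_fun setT (fun t => L * Q t)%R by exact: measurable_funM.
have v0 t : (0 <= L * Q t)%R by rewrite mulr_ge0// ltW.
have mQE : measurable_fun setT (EFin \o Q) by exact/measurable_EFinP.
have intv : \int[Pi]_t (L * Q t)%:E = L%:E * \int[Pi]_t (Q t)%:E.
  under eq_integral do rewrite EFinM.
  rewrite ge0_integralZl//; last by rewrite lee_fin ltW.
  by move=> t _; rewrite lee_fin.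
have N_fin : \int[Pi]_t (Q t)%:E \is a fin_num by rewrite ge0_fin_numE// ltW.
move: N_gt0 N_lty intv; rewrite -(fineK N_fin); set N := fine _.
rewrite lte_fin -EFinM => N0 _ intv.
rewrite /fractional_posterior vE integral_normalized_density//; first last.
- by move=> t; rewrite lee_fin !mulr_ge0.
- by apply/measurable_EFinP; do 2 apply: measurable_funM => //.
- by rewrite intv ltry.
- by rewrite intv lte_fin mulr_gt0.
have -> : \int[Pi]_t ((c * (n%:R * - ln (hellinger t)))%:E * (L * Q t)%:E) =
    (c * L)%:E * \int[Pi]_t (n%:R * - ln (hellinger t) * Q t)%:E.
  rewrite -ge0_integralZl//.
  - by apply: eq_integral => t _; rewrite -!EFinM; congr EFin; ring.
  - apply/measurable_EFinP; apply: measurable_funM => //.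
    exact: measurable_funM.
  - by move=> t _; rewrite lee_fin !mulr_ge0.
  - by rewrite lee_fin mulr_ge0// ltW.
rewrite intv !inver !gt_eqF ?mulr_gt0//.
rewrite muleAC -EFinM [X in _ = _ * X]muleC muleA -EFinM.
congr (_%:E * _); have Nn : (N != 0)%R by rewrite gt_eqF.
have Ln : (L != 0)%R by rewrite gt_eqF.
by field; rewrite Nn Ln.
Qed.

End fractional_posterior.

(** * The risk bound, from the prior mass and the PAC-Bayes inequality *)

Theorem theorem3p2 (R : realType) (d n : nat)
    (mu : probability (d.-tuple R) R)
    (nu : {sigma_finite_measure set (bool * d.-tuple R)%type -> \bar R})
    (C1 : R) (theta0 : d.-tuple R) :
  let P (theta : d.-tuple R) : probability (bool * d.-tuple R)%type R :=
    logit_law mu theta in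
  let K1 : R := 2 * fine ('E_mu[@norm2 R d]) in
  let tau : R := 1 / (n%:R * Num.sqrt d%:R) in
  let s : nat := norm0 theta0 in
  let eps : R :=
    Num.max K1 (4 * s%:R * ln (C1 * n%:R * Num.sqrt d%:R / s%:R)) / n%:R in
  (forall theta, P theta `<< nu) ->
  ('E_mu[(fun x => norm2 x ^+ 2)%R] < +oo)%E ->
  0 < C1 ->
  2 * d%:R * tau < C1 ->
  norm1 theta0 <= C1 - 2 * d%:R * tau ->
  (1 <= s < n)%N ->
  forall alpha : R, 0 < alpha < 1 ->
  (\int[tuple_measure (P theta0) n]_z
     \int[fractional_posterior alpha (prior tau C1) z]_theta
        renyi nu alpha (P theta) (P theta0)
   <= ((1 + alpha) / (1 - alpha) * eps)%:E)%E.
Proof.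
move=> P K1 tau s eps Pnu X2 C1_gt0 tauC t0_le /andP[s_ge1 s_ltn] alpha /andP[a0 a1].
have n_gt0 : (0 < n)%N by exact: leq_ltn_trans s_ltn.
have s_le_d : (s <= d)%N.
  by rewrite /s /norm0 -[X in (_ <= X)%N]card_ord; exact: max_card.
have d_gt0 : (0 < d)%N by exact: leq_trans s_le_d.
have nR : 0 < n%:R :> R by rewrite ltr0n.
have sR : 0 < s%:R :> R by rewrite ltr0n.
have dR : 0 < Num.sqrt d%:R :> R by rewrite sqrtr_gt0 ltr0n.
have tau_gt0 : 0 < tau by rewrite divr_gt0// mulr_gt0.
have radius : 2 * Num.sqrt d%:R * tau = 2 / n%:R.
  by rewrite /tau; field; rewrite !gt_eqF.
have [Pi [PiE mass]] := prior_probability tau_gt0 s_ge1 t0_le.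
set x := C1 * n%:R * Num.sqrt d%:R / s%:R in eps *.
have xE : C1 / (tau * s%:R) = x.
  by rewrite /x /tau; field; rewrite !gt_eqF.
(* Since [s tau <= d tau <= 2 d tau <= C1]; this makes [ln x], and hence [U], nonnegative. *)
have x_ge1 : 1 <= x.
  rewrite -xE ler_pdivlMr; last exact: mulr_gt0.
  rewrite mul1r.
  have : s%:R * tau <= d%:R * tau by rewrite ler_pM2r// ler_nat.
  have : 0 <= d%:R * tau by rewrite mulr_ge0// ltW.
  lra.
have x_gt0 : 0 < x by exact: lt_le_trans x_ge1.
rewrite -/s xE in mass.
pose q (t : d.-tuple R) (z : bool * d.-tuple R) : R :=
  logit_ratio theta0 t z `^ alpha.
have q0 t z : 0 <= q t z by exact: powR_ge0.
pose c1 : R := alpha * (2 / n%:R).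
have c1_ge0 : 0 <= c1 by rewrite mulr_ge0 ?divr_ge0// ltW.
pose W (z : n.-tuple (bool * d.-tuple R)) : R :=
  \sum_(i < n) norm2 (tnth z i).2.
have W0 z : 0 <= W z by apply: sumr_ge0 => i _; exact: norm2_ge0.
have mnorm : measurable_fun setT (fun z : bool * d.-tuple R => norm2 z.2).
  exact: (measurableT_comp (@measurable_norm2 R d) measurable_snd).
have mW : measurable_fun setT W.
  apply: measurable_sum => i.
  by apply: (measurableT_comp mnorm); exact: measurable_tnth.
pose c2 : R := 4 * s%:R * ln x.
have c2_ge0 : 0 <= c2 by rewrite !mulr_ge0// ln_ge0.
pose U z : R := c1 * W z + c2.
have U0 z : 0 <= U z by rewrite addr_ge0// mulr_ge0.
have mU : measurable_fun setT U.
  by apply: measurable_funD => //; exact: measurable_funM.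
have mQ (z : n.-tuple (bool * d.-tuple R)) :
    measurable_fun setT (fun t => \prod_(i < n) q t (tnth z i)).
  apply: measurable_prod => i _.
  exact: (measurableT_comp (measurable_powR_ratio_pair theta0 alpha)
    (pair2_measurable (tnth z i))).
(* Restrict the integral to the ball: there the integrand is at least [exp (- c1 * W z)], and the
   mass of the ball supplies [x ^- (4 * s) = exp (- c2)]. *)
have Q_ge z : ((expR (- U z))%:E <= \int[Pi]_t (\prod_(i < n) q t (tnth z i))%:E)%E.
  have mK := measurable_dist_ball theta0 tau.
  apply: (@le_trans _ _ (\int[Pi]_t
      ((expR (- (c1 * W z)))%:E * (\1_(dist_ball theta0 tau) t)%:E))%E).
    rewrite ge0_integralZl//; last first.
      by apply/measurable_EFinP; exact: measurable_indic.
    rewrite integral_indic// setIT.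
    have -> : expR (- U z) = expR (- (c1 * W z)) * x ^- (4 * s).
      rewrite /U opprD expRD; congr (_ * _); rewrite expRN; congr (_^-1).
      by rewrite /c2 -natrM expRM_natl lnK.
    by rewrite EFinM lee_wpmul2l// lee_fin expR_ge0.
  apply: ge0_le_integral_nonmeasurable => t.
    by rewrite mule_ge0// lee_fin expR_ge0.
  rewrite -EFinM lee_fin indicE.
  have [/set_mem tK|_] := boolP (t \in _); last by rewrite mulr0 prodr_ge0.
  rewrite mulr1 /W mulr_sumr -sumrN expR_sum.
  apply: ler_prod => i _; rewrite expR_ge0/=.
  set zi := tnth z i.
  have := dot_dist_ball zi.2 tau_gt0 d_gt0 tK; rewrite radius.
  move=> /logit_ratio_ge ratio_ge.
  rewrite (_ : - (c1 * norm2 zi.2) = alpha * - (norm2 zi.2 * (2 / n%:R))); last first.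
    by rewrite /c1; ring.
  rewrite -powR_expR; apply: ge0_ler_powR; rewrite ?nnegrE ?expR_ge0//.
  - exact: ltW.
  - exact/ltW/logit_ratio_gt0.
(* The numerator of each ratio is at most 1, which bounds the integrand uniformly in [t]. *)
have Q_lty z : (\int[Pi]_t (\prod_(i < n) q t (tnth z i))%:E < +oo)%E.
  pose b := \prod_(i < n) (logit_pmf theta0 (tnth z i).1 (tnth z i).2)^-1 `^ alpha.
  apply: (@le_lt_trans _ _ (\int[Pi]_t (cst b%:E t))%E).
    apply: ge0_le_integral_nonmeasurable => t; first by rewrite lee_fin prodr_ge0.
    rewrite lee_fin; apply: ler_prod => i _; rewrite q0/=.
    have p0 := @logit_pmf_gt0 _ _ theta0 (tnth z i).1 (tnth z i).2.
    apply: ge0_ler_powR; rewrite ?nnegrE.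
    - exact: ltW.
    - exact/ltW/logit_ratio_gt0.
    - by rewrite invr_ge0 ltW.
    - rewrite /logit_ratio -[leRHS]mul1r ler_pM2r ?invr_gt0//.
      by rewrite logit_pmfE; exact: sigmoid_le1.
  by rewrite integral_cst// [X in (_ * X)%E]probability_setT mule1 ltry.
have Q_gt0 z : (0 < \int[Pi]_t (\prod_(i < n) q t (tnth z i))%:E)%E.
  by apply: lt_le_trans (Q_ge z); rewrite lte_fin expR_gt0.
pose c : R := ((1 - alpha) * n%:R)^-1.
have a1' : 0 < 1 - alpha by rewrite subr_gt0.
have c_ge0 : 0 <= c by rewrite invr_ge0 mulr_ge0// ltW.
rewrite PiE.
under eq_fun => z do rewrite (integral_fractional_posterior_renyi a0 a1 Pnu n_gt0)
  ?Q_gt0 ?Q_lty//.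
apply: (le_trans (pac_bayes (measurable_powR_ratio_pair theta0 alpha) q0
  (hellingerE mu theta0 a0 a1) (hellinger_gt0 mu theta0 a0 a1)
  (hellinger_le1 mu theta0 a0 a1) mU U0 Q_ge Q_lty c_ge0)).
pose EX : R := fine 'E_mu[@norm2 R d].
have EXE : (\int[mu]_x (norm2 x)%:E = EX%:E)%E.
  rewrite /EX unlock fineK// ge0_fin_numE; first exact: integral_norm2_lty.
  by apply: integral_ge0 => y _; rewrite lee_fin norm2_ge0.
have intU : (\int[tuple_measure (P theta0) n]_z (U z)%:E =
    (c1 * (n%:R * EX) + c2)%:E)%E.
  have intW : (\int[tuple_measure (P theta0) n]_z (W z)%:E = (n%:R * EX)%:E)%E.
    rewrite (integral_tuple_measure_sum (P theta0) n mnorm); last first.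
      by move=> z; exact: norm2_ge0.
    rewrite (eq_bigr (fun=> EX%:E)); last first.
      by move=> i _; rewrite -EXE; exact: integral_logit_law_norm2.
    by rewrite sumEFin sumr_const card_ord mulr_natl.
  have [M ME] := tuple_measure_sigma_finite (P theta0) n.
  have M1 : M setT = 1%E by rewrite -ME; exact: tuple_measure_setT.
  move: intW; rewrite ME => intW.
  under eq_integral do rewrite EFinD EFinM.
  rewrite ge0_integralD//.
  - rewrite !ge0_integralZl//.
    + by rewrite intW integral_cst// [X in (_ + _ * X)%E]M1 mule1.
    + exact/measurable_EFinP.
    + by move=> z _; rewrite lee_fin.
  - by move=> z _; rewrite -EFinM lee_fin mulr_ge0.
  - by apply: measurable_funeM; exact/measurable_EFinP.
rewrite intU -EFinM lee_fin /eps -/c2 /K1 -/EX.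
have -> : c * (c1 * (n%:R * EX) + c2) = (alpha * (2 * EX) + c2) / ((1 - alpha) * n%:R).
  by rewrite /c /c1; field; rewrite !gt_eqF.
have -> : (1 + alpha) / (1 - alpha) * (Num.max (2 * EX) c2 / n%:R) =
    (alpha * Num.max (2 * EX) c2 + Num.max (2 * EX) c2) / ((1 - alpha) * n%:R).
  by field; rewrite !gt_eqF.
(* The maximum is used twice, once with weight [alpha] for [K1] and once for [c2]; hence the
   constant [1 + alpha]. *)
rewrite ler_pM2r ?invr_gt0 ?mulr_gt0//; apply: lerD.
  by rewrite ler_pM2l// le_max lexx.
by rewrite le_max lexx orbT.
Qed.
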